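(* Let $d\ge 2$. Let $\mathcal{C}_n^A$ be the dual Weyl cone of type $A_{n-1}$ built from exchangeable random vectors in $\mathbb{R}^d$ that are almost surely in type $A$ general position, and let $\mathcal{C}_n^B$ be the dual Weyl cone of type $B_n$ built from symmetrically exchangeable random vectors in $\mathbb{R}^d$ that are almost surely in type $B$ general position. The expected numbers of $k$-faces, for $k=0,\ldots,d-1$, are $$\mathbb{E} f_k(\mathcal{C}_n^A)=\frac{\binom{n-1}{k}D^A(n-k,d-k)}{D^A(n,d)}\cdot\frac{n!}{(n-k)!},\qquad \mathbb{E} f_k(\mathcal{C}_n^B)=\frac{2^k\binom{n}{k}D^B(n-k,d-k)}{D^B(n,d)}\cdot\frac{n!}{(n-k)!}.$$
   Context: Type $A$ general position: $y_1,\ldots,y_n\in\mathbb{R}^d$ with $n\ge d+1$ such that for every permutation $\sigma$ of $\{1,\ldots,n\}$ any $d$ of the vectors $y_{\sigma(1)}-y_{\sigma(2)},\ldots,y_{\sigma(n-1)}-y_{\sigma(n)}$ are linearly independent. Type $B$ general position: $y_1,\ldots,y_n\in\mathbb{R}^d$ with $n\ge d$ such that for every $\varepsilon\in\{\pm1\}^n$ and every permutation $\sigma$ of $\{1,\ldots,n\}$ any $d$ of the vectors $\varepsilon_1y_{\sigma(1)}-\varepsilon_2y_{\sigma(2)},\ldots,\varepsilon_{n-1}y_{\sigma(n-1)}-\varepsilon_ny_{\sigma(n)},\,\varepsilon_ny_{\sigma(n)}$ are linearly independent. Random vectors $Y_1,\ldots,Y_n$ are exchangeable if $(Y_1,\ldots,Y_n)$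 has the same distribution as $(Y_{\sigma(1)},\ldots,Y_{\sigma(n)})$ for every permutation $\sigma$, and symmetrically exchangeable if it has the same distribution as $(\varepsilon_1Y_{\sigma(1)},\ldots,\varepsilon_nY_{\sigma(n)})$ for every permutation $\sigma$ and every $\varepsilon\in\{\pm1\}^n$. $\operatorname{pos}\{x_1,\ldots,x_m\}=\{\sum_i\lambda_ix_i:\lambda_i\ge0\}$. The dual Weyl cone $\mathcal{C}_n^A$ is the random cone whose distribution is that of $\operatorname{pos}\{Y_1-Y_2,\ldots,Y_{n-1}-Y_n\}$ conditioned on the event that this positive hull is not equal to $\mathbb{R}^d$ (with $Y_i$ exchangeable and a.s. in type $A$ general position). The dual Weyl cone $\mathcal{C}_n^B$ is the random cone whose distribution is that of $\operatorname{pos}\{Y_1-Y_2,\ldots,Y_{n-1}-Y_n,Y_n\}$ conditioned on the event that this positive hull is not equal to $\mathbb{R}^d$ (with $Y_i$ symmetrically exchangeable and a.s. in type $B$ general position). For a polyhedral cone $C$, $f_k(C)$ is the number of its $k$-dimensional faces, where faces are obtained by replacing some (possibly none) of the half-spaces defining $C$ by their boundaries. $\genfrac{[}{]}{0pt}{}{n}{k}$ and $B[n,k]$ are defined by $t(t+1)\cdots(t+n-1)=\sum_{k=1}^n\genfrac{[}{]}{0pt}{}{n}{k}t^k$ and $(t+1)(t+3)\cdots(t+2n-1)=\sum_{k=0}^nB[n,k]t^k$, and are zero for $k$ outside $\{1,\ldots,n\}$, resp. $\{0,\ldots,n\}$. Put $D^A(m,k):=2\sum_{i\ge0}\genfrac{[}{]}{0pt}{}{m}{m-k+1+2i}$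 and $D^B(m,k):=2\sum_{i\ge0}B[m,m-k+1+2i]$. *)

(* Defs.v *)
From HB Require Import structures.
From mathcomp Require Import all_boot all_order all_algebra all_fingroup finmap.
From mathcomp Require Import all_classical all_reals all_analysis measurable_realfun.
Set Implicit Arguments.
Unset Strict Implicit.
Unset Printing Implicit Defensive.
Import Order.TTheory GRing.Theory Num.Theory.
Import numFieldNormedType.Exports.
Local Open Scope classical_set_scope.
Local Open Scope ring_scope.

(* The guard is only relevant for n = k = 0: the coefficient is then 1, while
   the convention is that the number vanishes for k outside 1..n. *)
Definition stirlingA (n k : nat) : nat :=
  if (0 < k <= n)%N then ((\prod_(i < n) ('X + (i : nat)%:P) : {poly nat})`_k)%R else 0.

Definition stirlingB (n k : nat) : nat :=
  ((\prod_(i < n) ('X + i.*2.+1%:P) : {poly nat})`_k)%R.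

(* D(m, k) is twice the sum over i >= 0 of the numbers of index m - k + 1 + 2i.
   The guard discards the negative indices; for i > k the index exceeds m, so
   that the terms vanish. *)
Definition DA (m k : nat) : nat :=
  (2 * \sum_(i < k.+1 | k <= m + 1 + i.*2) stirlingA m (m + 1 + i.*2 - k))%N.

Definition DB (m k : nat) : nat :=
  (2 * \sum_(i < k.+1 | k <= m + 1 + i.*2) stirlingB m (m + 1 + i.*2 - k))%N.

Section Cones.
Variables (R : realType) (d : nat).

Definition pos N (x : 'I_N -> 'rV[R]_d) : set 'rV[R]_d :=
  [set v | exists2 l : 'I_N -> R, (forall i, 0 <= l i) & v = \sum_i l i *: x i].

Definition dot (u v : 'rV[R]_d) : R := (u *m v^T) 0 0.

(* The intersection of the closed half-spaces {v | dot (u i) v <= 0}, where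
   those with i \in I are replaced by their boundaries. *)
Definition halfspaces m (u : 'I_m -> 'rV[R]_d) (I : {set 'I_m}) :
    set 'rV[R]_d :=
  [set v | forall i, if i \in I then dot (u i) v = 0 else dot (u i) v <= 0].

Definition is_face (C F : set 'rV[R]_d) : Prop :=
  exists m (u : 'I_m -> 'rV[R]_d) (I : {set 'I_m}),
    [/\ forall i, u i != 0, C = halfspaces u finset.set0 & F = halfspaces u I].

(* V is the linear hull of F, that is, the least subspace containing F. *)
Definition has_dim (F : set 'rV[R]_d) (k : nat) : Prop :=
  exists2 V : {vspace 'rV[R]_d},
    (forall W : {vspace 'rV[R]_d}, F `<=` [set` W] <-> (V <= W)%VS) &
    \dim V = k.

Definition nfaces (k : nat) (C : set 'rV[R]_d) : nat :=
  #|` fset_set [set F | is_face C F /\ has_dim F k] |.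

End Cones.

Section GeneralPosition.
Variables (R : realType) (d n : nat).
Implicit Type y : 'I_n -> 'rV[R]_d.

Definition ord_prev (i : 'I_n.-1) : 'I_n := widen_ord (leq_pred n) i.
Definition ord_next (i : 'I_n.-1) : 'I_n :=
  Ordinal (etrans (esym (ltn_predRL i n)) (ltn_ord i)).

Definition weylA y (i : 'I_n.-1) : 'rV[R]_d := y (ord_prev i) - y (ord_next i).

(* [insub i.+1 : option 'I_n] is [None] for the last index i, so the last
   vector is y i itself. *)
Definition weylB y (i : 'I_n) : 'rV[R]_d := y i - oapp y 0 (insub i.+1).

Definition any_lin_indep N (x : 'I_N -> 'rV[R]_d) : Prop :=
  forall f : 'I_d -> 'I_N, injective f -> row_free (\matrix_j x (f j)).

Definition general_positionA y : Prop :=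
  (d.+1 <= n)%N /\ forall s : 'S_n, any_lin_indep (weylA (y \o s)).

Definition signed_perm (e : 'I_n -> bool) (s : 'S_n) y (i : 'I_n) : 'rV[R]_d :=
  (-1) ^+ e i *: y (s i).

Definition general_positionB y : Prop :=
  (d <= n)%N /\ forall (e : 'I_n -> bool) (s : 'S_n), any_lin_indep (weylB (signed_perm e s y)).

End GeneralPosition.

Section Randomness.
Context (disp : measure_display) (T : measurableType disp) (R : realType).
Variables (P : probability T R) (d : nat).

Definition random_vectors n (Y : T -> 'I_n -> 'rV[R]_d) : Prop :=
  forall i j, measurable_fun [set: T] (fun w => Y w i 0 j).

(* The joint value of the vectors, in a type which carries the product
   sigma-algebra. *)
Definition joint n (Y : T -> 'I_n -> 'rV[R]_d) (w : T) :
    n.-tuple (d.-tuple (measurableTypeR R)) :=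
  [tuple [tuple Y w i 0 j | j < d] | i < n].

Definition same_distribution n (Y Z : T -> 'I_n -> 'rV[R]_d) : Prop :=
  forall A, measurable A ->
    pushforward P (joint Y) A = pushforward P (joint Z) A.

Definition exchangeable n (Y : T -> 'I_n -> 'rV[R]_d) : Prop :=
  forall s : 'S_n, same_distribution Y (fun w => Y w \o s).

Definition sym_exchangeable n (Y : T -> 'I_n -> 'rV[R]_d) : Prop :=
  forall (e : 'I_n -> bool) (s : 'S_n), same_distribution Y (fun w => signed_perm e s (Y w)).

Definition proper_pos N (X : T -> 'I_N -> 'rV[R]_d) : set T :=
  [set w | pos (X w) <> setT].

End Randomness.

Section ProperPosMeasurable.

Lemma mulmx_tr_eq0 (R : realType) m (a : 'rV[R]_m) : a *m a^T = 0 -> a = 0.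
Proof.
move=> /matrixP/(_ 0 0); rewrite !mxE => /eqP.
rewrite psumr_eq0; last by move=> i _; rewrite mxE -expr2 sqr_ge0.
move=> /allP h; apply/rowP => i; rewrite mxE.
by have := h i (mem_index_enum i); rewrite mxE mulf_eq0 orbb => /eqP.
Qed.

Lemma sum_rowE (R : realType) d N (x : 'I_N -> 'rV[R]_d) (l : 'I_N -> R) :
  \sum_i l i *: x i = (\row_i l i) *m (\matrix_i x i).
Proof.
rewrite mulmx_sum_row; apply: eq_bigr => i _.
by rewrite mxE rowK.
Qed.

(* The positive hull is the whole space iff X has full column rank and some
   positive row vector lies in the left kernel of X. The matrix on the right is
   the orthogonal projection onto that kernel, so that by continuity positivity
   can be tested on projections of rational vectors. *)
Lemma pos_fullP (R : realType) d N (x : 'I_N -> 'rV[R]_d) :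
  let X := \matrix_i x i in let G := X^T *m X in
  pos x = setT <->
  \det G != 0 /\ exists q : 'rV[rat]_N, forall i,
    0 < (map_mx ratr q *m (1%:M - X *m invmx G *m X^T)) 0 i.
Proof.
move=> X G; split=> [full|[detG [q q0]]]; last first.
  have uG : G \in unitmx by rewrite unitmxE unitfE.
  set lam := (_ *m _) in q0.
  have lamX : lam *m X = 0.
    rewrite /lam mulmxBr mulmx1 mulmxBl -!mulmxA -/G.
    by rewrite mulVmx// mulmx1 subrr.
  apply/seteqP; split=> // v _.
  set a := v *m invmx G *m X^T.
  have aX : a *m X = v by rewrite /a -!mulmxA -/G mulVmx// mulmx1.
  pose t := \sum_i `|a 0 i| / lam 0 i.
  exists (fun i => (a + t *: lam) 0 i) => [i|].
    rewrite mxE [X in _ + X]mxE.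
    have : `|a 0 i| / lam 0 i <= t.
      rewrite /t (bigD1 i)//= lerDl sumr_ge0// => j _.
      by rewrite divr_ge0// ltW.
    rewrite ler_pdivrMr// => h; have := ler_norm (- a 0 i).
    by rewrite normrN => h'; rewrite -lerBlDl sub0r (le_trans h').
  rewrite sum_rowE -/X (_ : \row_i _ = a + t *: lam).
    by rewrite mulmxDl aX -scalemxAl lamX scaler0 addr0.
  by apply/rowP => i; rewrite mxE.
have detG : \det G != 0.
  apply/negP => /det0P[v v0 vG].
  have vX : v *m X^T = 0.
    by apply: mulmx_tr_eq0; rewrite trmx_mul trmxK mulmxA -(mulmxA v) -/G vG mul0mx.
  have : setT v by [].
  rewrite -full => -[l _]; rewrite sum_rowE -/X => vE.
  move/negP: v0; apply; apply/eqP/mulmx_tr_eq0.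
  by rewrite {2}vE trmx_mul mulmxA vX mul0mx.
split=> //.
have uG : G \in unitmx by rewrite unitmxE unitfE.
set M := _ - _.
have : setT (- \sum_i x i) by [].
rewrite -full => -[l l0 lE].
pose lam := \row_i (1 + l i).
have lamX : lam *m X = 0.
  rewrite -sum_rowE; under eq_bigr do rewrite scalerDl scale1r.
  by rewrite big_split/= -lE subrr.
have lamM : lam *m M = lam.
  by rewrite /M mulmxBr mulmx1 2!mulmxA lamX !mul0mx subr0.
pose K := 1 + \sum_j \sum_i `|M j i|.
have K0 : 0 < K.
  by rewrite ltr_wpDr// sumr_ge0// => j _; rewrite sumr_ge0.
have /choice[q qP] : forall j, exists r : rat, `|ratr r - lam 0 j| < K^-1.
  move=> j.
  have [|r] := @rat_in_itvoo R (lam 0 j - K^-1) (lam 0 j + K^-1).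
    by rewrite ltrD2l gtrN// invr_gt0.
  rewrite in_itv/= => /andP[r1 r2]; exists r.
  by rewrite ltr_distl r1.
exists (\row_j q j) => i.
set Q := map_mx _ _.
have -> : Q *m M = lam + (Q - lam) *m M.
  by rewrite mulmxBl lamM addrC subrK.
rewrite mxE -[ltLHS](subrr 1); apply: ler_ltD.
  by rewrite mxE lerDl.
rewrite ltrNl; apply: le_lt_trans (_ : K^-1 * (K - 1) < 1); last first.
  by rewrite mulrBr mulVf ?gt_eqF// mulr1 gtrBl invr_gt0.
apply: le_trans (ler_norm _) _.
rewrite normrN mxE (le_trans (ler_norm_sum _ _ _))//.
rewrite /K addrAC subrr add0r mulr_sumr; apply: ler_sum => j _.
rewrite normrM; apply: ler_pM => //.
  by have := ltW (qP j); rewrite !mxE.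
by rewrite (bigD1 i)//= lerDl sumr_ge0.
Qed.

Context (disp : measure_display) (T : measurableType disp) (R : realType).

Let mx_meas m p (A : T -> 'M[R]_(m, p)) : Prop :=
  forall i j, measurable_fun [set: T] (fun w => A w i j).

Let mulmx_meas m p r (A : T -> 'M[R]_(m, p)) (B : T -> 'M[R]_(p, r)) :
  mx_meas A -> mx_meas B -> mx_meas (fun w => A w *m B w).
Proof.
move=> mA mB i j; under eq_fun do rewrite mxE.
apply: measurable_sum => k; exact: measurable_funM.
Qed.

Let tr_meas m p (A : T -> 'M[R]_(m, p)) : mx_meas A -> mx_meas (fun w => (A w)^T).
Proof. by move=> mA i j; under eq_fun do rewrite mxE; exact: mA. Qed.

Let det_meas m (A : T -> 'M[R]_m) :
  mx_meas A -> measurable_fun [set: T] (fun w => \det (A w)).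
Proof.
move=> mA; apply: measurable_sum => s.
by apply: measurable_funM => //; apply: measurable_prod.
Qed.

Let adj_meas m (A : T -> 'M[R]_m) : mx_meas A -> mx_meas (fun w => \adj (A w)).
Proof.
move=> mA i j; under eq_fun do rewrite mxE /cofactor.
apply: measurable_funM => //; apply: det_meas => k l.
by under eq_fun do rewrite !mxE; exact: mA.
Qed.

Lemma measurable_proper_pos d N (X : T -> 'I_N -> 'rV[R]_d) :
  random_vectors X -> measurable (proper_pos X).
Proof.
move=> mX.
pose M w := \matrix_i X w i; pose G w := (M w)^T *m M w.
have mM : mx_meas M by move=> i j; under eq_fun do rewrite mxE; exact: mX.
have mG : mx_meas G by apply: mulmx_meas => //; exact: tr_meas.
pose h (q : 'rV[rat]_N) w i : R := \det (G w) * (\det (G w) * ratr (q 0 i) -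
  (map_mx ratr q *m (M w *m \adj (G w) *m (M w)^T)) 0 i).
have hE w q i : \det (G w) != 0 -> h q w i = \det (G w) ^+ 2 *
    (map_mx ratr q *m (1%:M - M w *m invmx (G w) *m (M w)^T)) 0 i.
  move=> dG; rewrite /h /invmx unitmxE unitfE dG.
  rewrite -scalemxAr -scalemxAl mulmxBr mulmx1 -scalemxAr.
  by rewrite !mxE expr2 -mulrA !mulrBr (mulVKf dG).
have mh q i : measurable_fun [set: T] (fun w => h q w i).
  apply: measurable_funM; first exact: det_meas.
  apply: measurable_funB.
    by apply: measurable_funM => //; exact: det_meas.
  apply: mulmx_meas => //; apply: mulmx_meas; last exact: tr_meas.
  by apply: mulmx_meas => //; exact: adj_meas.
rewrite [X in measurable X](_ : _ = ~` ([set w | \det (G w) != 0] `&`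
    \bigcup_(q in [set: 'rV[rat]_N]) \bigcap_(i in [set: 'I_N]) [set w | 0 < h q w i])).
  apply: measurableC; apply: measurableI.
    rewrite -[X in measurable X]setTI; pose D w : R := \det (G w).
    have mD : measurable_fun [set: T] D by exact: det_meas.
    rewrite (_ : [set w | _] = D @^-1` ~` [set 0]).
      by apply: mD => //; apply: measurableC; exact: measurable_set1.
    by apply/seteqP; split=> w /= /eqP.
  apply: countable_bigcupT_measurable => [|q]; first exact: countableP.
  apply: fin_bigcap_measurable => // i _.
  rewrite -[X in measurable X]setTI (_ : [set w | _] =
    (fun w => h q w i) @^-1` `]0, +oo[%classic).
    by apply: mh => //; exact: measurable_itv.
  by apply/seteqP; split=> w /=; rewrite in_itv/= andbT.
have fullP w : pos (X w) = setT <-> \det (G w) != 0 /\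
    exists q, forall i, 0 < h q w i.
  apply: (iff_trans (pos_fullP _)); split=> -[dG [q hq]]; split=> //; exists q => i.
    by rewrite hE// pmulr_rgt0 ?hq// exprn_even_gt0.
  by have := hq i; rewrite hE// pmulr_rgt0 ?exprn_even_gt0.
apply: eq_set => w; apply/propext; apply: not_iff_compat.
apply: (iff_trans (fullP w)); split=> -[dG].
  by move=> [q hq]; split=> //; exists q => // i _; exact: hq.
by move=> [q _ hq]; split=> //; exists q => i; exact: hq.
Qed.

Lemma random_vectors_weylA d n (Y : T -> 'I_n -> 'rV[R]_d) :
  random_vectors Y -> random_vectors (fun w => weylA (Y w)).
Proof.
move=> mY i j; under eq_fun do rewrite !mxE.
by apply: measurable_funB; exact: mY.
Qed.

Lemma random_vectors_weylB d n (Y : T -> 'I_n -> 'rV[R]_d) :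
  random_vectors Y -> random_vectors (fun w => weylB (Y w)).
Proof.
move=> mY i j; under eq_fun do rewrite /weylB !mxE.
apply: measurable_funB; first exact: mY.
by case: insub => [k|] /=; [exact: mY | exact: measurable_cst].
Qed.

End ProperPosMeasurable.

Section DualWeylCones.
Context (disp : measure_display) (T : measurableType disp) (R : realType).
Variables (P : probability T R) (d : nat).

(* The conditional probability B |-> P (B `&` A) / P A; it is P itself in the
   degenerate case P A = 0. *)
Definition cond_prob (A : set T) (mA : measurable A) : probability T R :=
  mnormalize (mrestr P mA) P.

(* The dual Weyl cones are realised as the random cones w |-> pos (weyl (Y w))
   on the probability spaces obtained by conditioning on properness. *)
Definition dual_weyl_probA n (Y : T -> 'I_n -> 'rV[R]_d)
    (mY : random_vectors Y) : probability T R :=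
  cond_prob (measurable_proper_pos (random_vectors_weylA mY)).

Definition dual_weyl_probB n (Y : T -> 'I_n -> 'rV[R]_d)
    (mY : random_vectors Y) : probability T R :=
  cond_prob (measurable_proper_pos (random_vectors_weylB mY)).

Definition dual_weyl_coneA n (Y : T -> 'I_n -> 'rV[R]_d) (w : T) :
  set 'rV[R]_d := pos (weylA (Y w)).

Definition dual_weyl_coneB n (Y : T -> 'I_n -> 'rV[R]_d) (w : T) :
  set 'rV[R]_d := pos (weylB (Y w)).

End DualWeylCones.

(* Main.v *)
Require Import Defs.
From HB Require Import structures.
From mathcomp Require Import all_boot all_order all_algebra all_fingroup finmap.
From mathcomp Require Import all_classical all_reals all_analysis measurable_realfun.
From mathcomp Require Import zify ring lra.
Set Implicit Arguments.
Unset Strict Implicit.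
Unset Printing Implicit Defensive.
Import Order.TTheory GRing.Theory Num.Theory.
Import numFieldNormedType.Exports.
Local Open Scope classical_set_scope.
Local Open Scope ring_scope.

(** The expected number of k-faces is a ratio of two chamber counts, by averaging
    over the symmetry group.

    Let x_1, ..., x_N be the generators of the positive hull: the consecutive
    differences of the vectors, followed in type B by the last vector. In general
    position a k-face, k < d, is spanned by exactly k generators, those that lie
    on a supporting hyperplane. So f_k is the number of the sets J of k indices
    for which some v is orthogonal to x_i for i in J and has a negative product
    with all other x_i (nfaces_fcount); this uses that a positive hull is an
    intersection of half-spaces (pos_polyhedral). In the same way the hull is
    proper iff this holds for some v and J empty. As exchangeability makes the
    probability of each such event invariant, the expectation of f_k on the event
    of properness, multiplied by the order of the group, is the expectation of the
    sum of f_k over all (signed) permutations of the vectors. That sum turns out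
    to be a constant, which depends on n, d and k only, and dividing by the
    constant for k = 0 gives the conditional expectation (expected_faces).

    To evaluate the constant, let v range over a subspace V of dimension e. The
    conditions on v say that its products with the permuted vectors increase
    along the permutation, with equality at the places in J. For k > 0 one
    singles out one of the equalities, between the vectors b and a say: it
    restricts v to the hyperplane where b and a have the same product, and b can
    be forgotten. This expresses the constant for (n, e, k) by the one for
    (n-1, e-1, k-1) and reduces the problem to k = 0 (totalA_contract,
    totalB_contract). For k = 0 one counts the chambers met by V in a reflection
    arrangement. Removing the vector b, each chamber of the others is subdivided
    by the hyperplanes of b, which do not meet each other inside it; so the count
    for (n, e) is the one for (n-1, e) plus one copy of the one for (n-1, e-1)
    for each hyperplane of b, of which there are n-1 in type A and 2n-1 in type B
    (totalA0_insert, totalB0_insert). The coefficients of t(t+1)...(t+n-1) and of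
    (t+1)(t+3)...(t+2n-1) obey the same recursion, which identifies the count with
    DA and DB (DA_chambers, DB_chambers).

    Both recursions are carried by one notion of general position of linear forms
    on a subspace (generic), which is stable under deleting a form and under
    restricting to the kernel of one. *)

(** * The pairing of vectors, and subspaces as sets *)

Section Pairing.
Variables (R : realType) (d : nat).
Implicit Types (u v h : 'rV[R]_d) (V K : set 'rV[R]_d).

Lemma dotDl u v h : dot (u + v) h = dot u h + dot v h.
Proof. by rewrite /dot mulmxDl mxE. Qed.

Lemma dotNl u h : dot (- u) h = - dot u h.
Proof. by rewrite /dot mulNmx mxE. Qed.

Lemma dotBl u v h : dot (u - v) h = dot u h - dot v h.
Proof. by rewrite dotDl dotNl. Qed.

Lemma dotZl a u h : dot (a *: u) h = a * dot u h.
Proof. by rewrite /dot -scalemxAl mxE. Qed.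

Lemma dot0l h : dot 0 h = 0.
Proof. by rewrite /dot mul0mx mxE. Qed.

Lemma dotC u v : dot u v = dot v u.
Proof. by rewrite /dot !mxE; apply: eq_bigr => i _; rewrite !mxE mulrC. Qed.

Lemma dotDr u v h : dot h (u + v) = dot h u + dot h v.
Proof. by rewrite dotC dotDl !(dotC h). Qed.

Lemma dotZr a u h : dot h (a *: u) = a * dot h u.
Proof. by rewrite dotC dotZl dotC. Qed.

Lemma dot0r h : dot h 0 = 0.
Proof. by rewrite dotC dot0l. Qed.

Lemma dot_suml (I : Type) (r : seq I) (Q : pred I) (F : I -> 'rV[R]_d) h :
  dot (\sum_(i <- r | Q i) F i) h = \sum_(i <- r | Q i) dot (F i) h.
Proof. by apply: (big_morph (fun v => dot v h)); [move=> u v; exact: dotDl | exact: dot0l]. Qed.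

Definition subspace V := V 0 /\ forall a u v, V u -> V v -> V (a *: u + v).

Definition perp h : set 'rV[R]_d := [set v | dot h v = 0].
Definition below h : set 'rV[R]_d := [set v | dot h v < 0].
Definition above h : set 'rV[R]_d := [set v | 0 < dot h v].

Lemma subspaceT : subspace setT.
Proof. by []. Qed.

Lemma subspace_perp V h : subspace V -> subspace (V `&` perp h).
Proof.
move=> [V0 VD]; split; first by split=> //; exact: dot0r.
move=> a u v [Vu hu] [Vv hv]; split; first exact: VD.
by rewrite /perp /= dotDr dotZr hu hv mulr0 addr0.
Qed.

(** The counting arguments add up indicators of the non-emptiness of cells. *)
Definition nonempty K : nat := `[< K !=set0 >].

Lemma nonempty1 K v : K v -> nonempty K = 1%N.
Proof. by move=> Kv; rewrite /nonempty; case: asboolP => // -[]; exists v. Qed.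

Lemma nonempty0 K : (forall v, ~ K v) -> nonempty K = 0%N.
Proof. by move=> K0; rewrite /nonempty; case: asboolP => // -[v /K0]. Qed.

(** Openness relative to V is asked for along segments only; this is all that
    cutting by hyperplanes uses. *)
Definition open_convex V K :=
  [/\ K `<=` V,
      forall v w, K v -> K w ->
        forall t : R, 0 <= t <= 1 -> K (t *: v + (1 - t) *: w) &
      forall v w, K v -> V w -> exists2 e : R, 0 < e &
        forall t, 0 <= t <= e -> K (v + t *: w)].

Lemma open_convex_subspace V : subspace V -> open_convex V V.
Proof.
move=> [V0 VD]; split=> // [v w Kv Kw t _|v w Kv Vw].
  by apply: (VD) => //; rewrite -[(1 - t) *: w]addr0; exact: VD.
by exists 1 => // t _; rewrite addrC; apply: VD.
Qed.

Lemma open_convex_lt0 V K h :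
  open_convex V K -> open_convex V (K `&` below h).
Proof.
move=> [KV Kc Ko]; split=> [v [/KV]//|v w [Kv /= hv] [Kw /= hw] t t01|].
  split; first exact: Kc.
  rewrite /below /above /perp /= dotDr !dotZr; case/andP: t01 => t0 t1; rewrite /below /= in hv hw.
  by have [t2|t2] := lerP t (1 / 2); nra.
move=> v w [Kv hv] Vw; rewrite /below /= in hv; have [e e0 eK] := Ko _ _ Kv Vw.
pose b := 1 + `|dot h w|.
have b0 : 0 < b by rewrite ltr_pwDl.
exists (Num.min e (- dot h v / (2 * b))).
  by rewrite lt_min e0/= divr_gt0 ?mulr_gt0// oppr_gt0.
move=> t /andP[t0]; rewrite le_min => /andP[te tb]; split.
  by apply: eK; rewrite t0.
rewrite /below /above /perp /= dotDr dotZr.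
have tb' : t * (2 * b) <= - dot h v by rewrite -ler_pdivlMr// mulr_gt0.
have := ler_norm (dot h w) => hw.
have : t * dot h w <= t * b by rewrite ler_wpM2l// /b; lra.
nra.
Qed.

(** A hyperplane which meets a relatively open convex set cuts it into two
    parts; otherwise the set lies on one side. *)
Lemma cut V K h : subspace V -> open_convex V K ->
  (exists2 v, V v & dot h v != 0) ->
  (nonempty (K `&` below h) +
   nonempty (K `&` above h) = nonempty K + nonempty (K `&` perp h))%N.
Proof.
move=> [V0 VD] [KV Kc Ko] [u Vu hu].
have [[v [Kv hv]]|noz] := pselect (exists v, (K `&` perp h) v).
  have [w Vw hw] : exists2 w, V w & 0 < dot h w.
    have [hu0|hu0|/eqP] := ltrgt0P (dot h u); first by exists u.
      by exists (- u); [rewrite -scaleN1r -[_ *: _]addr0; exact: VD |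
                        rewrite dotC dotNl dotC oppr_gt0].
    by rewrite (negPf hu).
  have VNw : V (- w) by rewrite -scaleN1r -[_ *: _]addr0; exact: VD.
  have [e e0 eK] := Ko _ _ Kv Vw; have [f f0 fK] := Ko _ _ Kv VNw.
  rewrite (@nonempty1 (_ `&` perp _) v)// (@nonempty1 K v)//.
  rewrite (@nonempty1 (_ `&` below _) (v + f *: - w)) ?(@nonempty1 (_ `&` above _) (v + e *: w))//.
    split; first by apply: eK; rewrite (ltW e0) lexx.
    by rewrite /below /above /perp /= dotDr dotZr hv add0r mulr_gt0.
  split; first by apply: fK; rewrite (ltW f0) lexx.
  rewrite /below /above /perp /= dotDr dotZr hv add0r (dotC _ (- w)) dotNl dotC.
  by rewrite mulrN oppr_lt0 mulr_gt0.
rewrite (@nonempty0 (_ `&` perp _)) ?addn0; last by move=> v hv; apply: noz; exists v.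
have nolr v w : K v -> (dot h v < 0)%R -> K w -> 0 < dot h w -> False.
  move=> Kv hv Kw hw; apply: noz.
  pose s := dot h w - dot h v; have s0 : 0 < s by rewrite /s; lra.
  have st : dot h w / s + - dot h v / s = 1 by rewrite -mulrDl mulfV ?gt_eqF.
  have t0 : 0 <= dot h w / s by rewrite divr_ge0// ltW.
  have t1 : 0 <= - dot h v / s by rewrite divr_ge0// ltW// oppr_gt0.
  exists ((dot h w / s) *: v + (1 - dot h w / s) *: w); split.
    by apply: Kc => //; rewrite t0/=; lra.
  rewrite /perp /= dotDr !dotZr (_ : 1 - _ = - dot h v / s); last by lra.
  by rewrite mulrAC [X in _ + X]mulrAC -mulrDl mulNr (mulrC (dot h w)) subrr mul0r.
have [[v [Kv hv]]|nol] := pselect (exists v, (K `&` below h) v).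
  rewrite (@nonempty1 (_ `&` below _) v)// (@nonempty1 K v)// nonempty0// => w [Kw hw].
  exact: nolr Kv hv Kw hw.
rewrite (@nonempty0 (_ `&` below _)) ?add0n; last by move=> v hv; apply: nol; exists v.
congr (nonempty _); apply/seteqP; split=> [v []//|v Kv]; split=> //=.
have [//|hv|hv] := ltrgt0P (dot h v).
  by case: nol; exists v.
by case: noz; exists v.
Qed.

End Pairing.

(** * Cells of a family of vectors, and general position *)

Section Cells.
Variables (R : realType) (d : nat).
Implicit Types (V : set 'rV[R]_d) (v : 'rV[R]_d).

(** For V the whole space, J is the set of the generators x i that span the
    face of the positive hull which a vector of the cell exposes. *)
Definition cell N V (x : 'I_N -> 'rV[R]_d) (J : {set 'I_N}) : set 'rV[R]_d :=
  [set v | V v /\ forall i, if i \in J then dot (x i) v = 0 else dot (x i) v < 0].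

Definition fcount k N V (x : 'I_N -> 'rV[R]_d) : nat :=
  \sum_(J : {set 'I_N} | #|J| == k) nonempty (cell V x J).

(** General position of the forms x i on a subspace V which has dimension e
    modulo their common kernel: fewer than e of them do not determine another
    one, and e of them determine all. Dimensions are not mentioned, so that V may
    be cut down by hyperplanes without any bookkeeping. *)
Definition generic e N V (x : 'I_N -> 'rV[R]_d) : Prop :=
  (forall J : {set 'I_N}, (#|J| < e)%N -> forall j, j \notin J ->
     exists v, [/\ V v, forall i, i \in J -> dot (x i) v = 0 & dot (x j) v != 0]) /\
  (forall J : {set 'I_N}, (e <= #|J|)%N -> forall v, V v ->
     (forall i, i \in J -> dot (x i) v = 0) -> forall j, dot (x j) v = 0).

Lemma cell_ext N V (x x' : 'I_N -> 'rV[R]_d) J :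
  (forall v i, V v -> dot (x i) v = dot (x' i) v) -> cell V x J = cell V x' J.
Proof.
move=> xx; apply/seteqP; split=> v [Vv h]; split=> // i; have := h i.
  by rewrite xx.
by rewrite -xx.
Qed.

Lemma fcount_ext k N V (x x' : 'I_N -> 'rV[R]_d) :
  (forall v i, V v -> dot (x i) v = dot (x' i) v) -> fcount k V x = fcount k V x'.
Proof. by move=> xx; apply: eq_bigr => J _; rewrite (cell_ext J xx). Qed.

Lemma generic_ext e N V (x x' : 'I_N -> 'rV[R]_d) :
  (forall v i, V v -> dot (x i) v = dot (x' i) v) -> generic e V x -> generic e V x'.
Proof.
move=> xx [g1 g2]; split=> J cJ.
  move=> j jJ; have [v [Vv vJ vj]] := g1 J cJ j jJ; exists v; split=> //.
    by move=> i iJ; rewrite -xx// vJ.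
  by rewrite -xx.
move=> v Vv vJ j; rewrite -xx//; apply: (g2 J) => // i iJ.
by rewrite xx// vJ.
Qed.

Lemma card_lift N (l : 'I_N.+1) (J : {set 'I_N}) : #|lift l @: J| = #|J|.
Proof. exact/card_imset/lift_inj. Qed.

Lemma mem_lift N (l : 'I_N.+1) (J : {set 'I_N}) i :
  (lift l i \in lift l @: J) = (i \in J).
Proof. exact/mem_imset/lift_inj. Qed.

Lemma notin_lift N (l : 'I_N.+1) (J : {set 'I_N}) : l \notin lift l @: J.
Proof. by apply/imsetP => -[i _ /eqP]; rewrite (negPf (neq_lift _ _)). Qed.

Lemma generic_delete e N V (x : 'I_N.+1 -> 'rV[R]_d) l :
  generic e V x -> generic e V (x \o lift l).
Proof.
move=> [g1 g2]; split=> J cJ.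
  move=> j jJ; have [||v [Vv vJ vj]] := g1 (lift l @: J) _ (lift l j).
  - by rewrite card_lift.
  - by rewrite mem_lift.
  - by exists v; split=> // i iJ; apply: vJ; rewrite mem_lift.
move=> v Vv vJ j; apply: (g2 (lift l @: J)) => //.
  by rewrite card_lift.
by move=> i /imsetP[i' /vJ iJ ->].
Qed.

Lemma generic_contract e N V (x : 'I_N.+1 -> 'rV[R]_d) l :
  generic e.+1 V x -> generic e (V `&` perp (x l)) (x \o lift l).
Proof.
move=> [g1 g2].
have cl (J : {set 'I_N}) : #|l |: (lift l @: J)| = #|J|.+1.
  by rewrite cardsU1 notin_lift card_lift add1n.
split=> J cJ.
  move=> j jJ; have [||v [Vv vJ vj]] := g1 (l |: lift l @: J) _ (lift l j).
  - by rewrite cl.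
  - by rewrite in_setU1 mem_lift eq_sym (negPf (neq_lift _ _)).
  - exists v; split=> //; first by split=> //; apply: vJ; rewrite setU11.
    by move=> i iJ; apply: vJ; rewrite in_setU1 mem_lift iJ orbT.
move=> v [Vv vl] vJ j; apply: (g2 (l |: lift l @: J)) => //; first by rewrite cl.
by move=> i; rewrite in_setU1 => /predU1P[->//|/imsetP[i' /vJ iJ ->]].
Qed.

(** Both sides count the non-empty cells of index J with |J| = k+1 together
    with an element l of J. *)
Lemma fcount_contract k N V (x : 'I_N.+1 -> 'rV[R]_d) :
  (k.+1 * fcount k.+1 V x = \sum_l fcount k (V `&` perp (x l)) (x \o lift l))%N.
Proof.
rewrite /fcount big_distrr/=.
transitivity (\sum_(J : {set 'I_N.+1} | #|J| == k.+1) \sum_(l in J) nonempty (cell V x J))%N.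
  by apply: eq_bigr => J /eqP cJ; rewrite sum_nat_const cJ.
rewrite (exchange_big_dep predT)//=; apply: eq_bigr => l _.
rewrite (reindex_onto (fun J : {set 'I_N} => l |: lift l @: J)
                      (fun J => lift l @^-1: J)) /=; last first.
  move=> J /andP[_ lJ]; apply/setP => i; rewrite in_setU1.
  case: (unliftP l i) => [j|] ->; last by rewrite eqxx lJ.
  by rewrite eq_sym (negPf (neq_lift _ _)) mem_lift inE.
apply: eq_big => [J|J _].
  rewrite cardsU1 notin_lift card_lift add1n eqSS setU11 andbT.
  rewrite (_ : (_ == J)) ?andbT//; apply/eqP/setP => i.
  by rewrite inE in_setU1 mem_lift eq_sym (negPf (neq_lift _ _)).
congr nonempty; apply/seteqP; split=> v /= [].
  move=> Vv h; split.
    by split=> //; have := h l; rewrite setU11.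
  by move=> i; have := h (lift l i); rewrite in_setU1 eq_sym (negPf (neq_lift _ _)) mem_lift.
move=> [Vv vl] h; split=> // i; rewrite in_setU1.
case: (unliftP l i) => [j|] ->; last by rewrite eqxx.
by rewrite eq_sym (negPf (neq_lift _ _)) mem_lift; exact: h.
Qed.

Lemma fcount0 N V (x : 'I_N -> 'rV[R]_d) :
  fcount 0 V x = nonempty (cell V x finset.set0).
Proof.
rewrite /fcount (big_pred1 finset.set0)// => J; by rewrite cards_eq0.
Qed.

End Cells.

(** * Chains of differences *)

Section Chains.
Variables (R : realType) (d : nat).

Definition extend n (p : 'I_n -> 'rV[R]_d) (k : nat) : 'rV[R]_d :=
  oapp p 0 (insub k).

(** The extension by zero makes this one formula for both types: for n vectors,
    the generators of type A are the first n-1 differences, and those of type B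
    all n differences. *)
Definition chain N n (p : 'I_n -> 'rV[R]_d) (i : 'I_N) : 'rV[R]_d :=
  extend p i - extend p i.+1.

Lemma extend_ord n (p : 'I_n -> 'rV[R]_d) (i : 'I_n) : extend p i = p i.
Proof. by rewrite /extend valK. Qed.

Lemma extend_out n (p : 'I_n -> 'rV[R]_d) k : (n <= k)%N -> extend p k = 0.
Proof. by move=> nk; rewrite /extend insubN// -leqNgt. Qed.

Lemma extend_lift n (p : 'I_n.+1 -> 'rV[R]_d) (l : 'I_n.+1) k :
  extend (p \o lift l) k = extend p (bump l k).
Proof.
have [kn|nk] := ltnP k n.
  by rewrite -[k]/(val (Ordinal kn)) extend_ord /= -(extend_ord p (lift l _)).
rewrite !extend_out//; have := ltn_ord l; rewrite /bump; lia.
Qed.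

Lemma weylA_chain n (y : 'I_n.+1 -> 'rV[R]_d) : weylA y = chain y.
Proof.
apply/funext => i; rewrite /weylA /chain.
by rewrite -(extend_ord y (ord_prev i)) -(extend_ord y (ord_next i)).
Qed.

Lemma weylB_chain n (y : 'I_n -> 'rV[R]_d) : weylB y = chain y.
Proof. by apply/funext => i; rewrite /weylB /chain extend_ord. Qed.

Lemma chain_at N n (p : 'I_n.+1 -> 'rV[R]_d) (l : 'I_N) (l' : 'I_n.+1) :
  l = l' :> nat -> chain p l = p l' - extend (p \o lift l') l.
Proof. by move=> ll; rewrite /chain extend_lift ll /bump leqnn extend_ord. Qed.

(** Of the two vectors that agree the first is removed, so that the last
    difference of type B, whose second vector is zero, is no exception. *)
Lemma chain_contract N n (p : 'I_n.+1 -> 'rV[R]_d) (l : 'I_N.+1) (l' : 'I_n.+1)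
    v (i : 'I_N) : l = l' :> nat -> dot (chain p l) v = 0 ->
  dot (chain p (lift l i)) v = dot (chain (p \o lift l') i) v.
Proof.
move=> ll; rewrite /chain !dotBl !extend_lift -ll /= => /eqP; rewrite subr_eq0 => /eqP h.
rewrite /bump; have [li|il] := leqP l i; first by rewrite leqW// !add1n.
rewrite !add0n; have [il'|//] := leqP l i.+1.
have -> : i.+1 = l by apply/eqP; rewrite eqn_leq il' il.
by rewrite h add1n.
Qed.

Lemma chain_delete N n (p : 'I_n.+1 -> 'rV[R]_d) :
  chain p \o lift (ord0 : 'I_N.+1) = chain (p \o lift ord0).
Proof. by apply/funext => i; rewrite /chain !extend_lift. Qed.

Lemma fcount_chain_contract k N n V (p : 'I_n.+1 -> 'rV[R]_d) (l : 'I_N.+1) (l' : 'I_n.+1) :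
  l = l' :> nat ->
  fcount k (V `&` perp (chain p l)) (chain p \o lift l) =
  fcount k (V `&` perp (p l' - extend (p \o lift l') l)) (chain (p \o lift l') : 'I_N -> _).
Proof.
move=> ll; rewrite -(chain_at p ll); apply: fcount_ext => v i [_ vl].
exact: chain_contract.
Qed.

Lemma generic_chain_contract e N n V (p : 'I_n.+1 -> 'rV[R]_d) (l : 'I_N.+1) (l' : 'I_n.+1) :
  l = l' :> nat -> generic e.+1 V (chain p : 'I_N.+1 -> _) ->
  generic e (V `&` perp (p l' - extend (p \o lift l') l)) (chain (p \o lift l') : 'I_N -> _).
Proof.
move=> ll /(generic_contract l); rewrite -(chain_at p ll).
by apply: generic_ext => v i [_ vl]; exact: chain_contract.
Qed.

Lemma generic_chain_delete e N n V (p : 'I_n.+1 -> 'rV[R]_d) :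
  generic e V (chain p : 'I_N.+1 -> _) ->
  generic e V (chain (p \o lift ord0) : 'I_N -> _).
Proof. by move=> /(generic_delete ord0); rewrite chain_delete. Qed.

Definition chamber V N n (p : 'I_n -> 'rV[R]_d) : set 'rV[R]_d :=
  cell V (chain p : 'I_N -> _) finset.set0.

Lemma chamberP V N n (p : 'I_n -> 'rV[R]_d) v : chamber V N p v <->
  V v /\ forall k, (k < N)%N -> dot (extend p k) v < dot (extend p k.+1) v.
Proof.
split=> -[Vv h]; split=> //; first move=> k kN.
  by have := h (Ordinal kN); rewrite inE /chain dotBl subr_lt0.
by move=> i; rewrite inE /chain dotBl subr_lt0; exact: h.
Qed.

Lemma chamber_mono V N n (p : 'I_n -> 'rV[R]_d) v : chamber V N p v ->
  forall i j, (i < j)%N -> (j <= N)%N -> dot (extend p i) v < dot (extend p j) v.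
Proof.
move=> /chamberP[_ h] i j; elim: j => // j ih; rewrite ltnS leq_eqVlt => ij jN.
apply: le_lt_trans (h j jN).
by case/predU1P: ij => [->//|ij]; apply/ltW/ih => //; exact: ltnW.
Qed.

Lemma open_convex_chamber V N n (p : 'I_n -> 'rV[R]_d) :
  subspace V -> open_convex V (chamber V N p).
Proof.
move=> sV; elim: N => [|N ih].
  rewrite (_ : chamber V 0 p = V); first exact: open_convex_subspace.
  by apply/seteqP; split=> v => [/chamberP[]//|Vv]; apply/chamberP.
rewrite (_ : chamber V N.+1 p = chamber V N p `&` below (extend p N - extend p N.+1)).
  exact: open_convex_lt0.
apply/seteqP; split=> v.
  move=> /chamberP[Vv h]; split; last by rewrite /below /= dotBl subr_lt0 h.
  by apply/chamberP; split=> // k kN; apply: h; exact: ltnW.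
case=> /chamberP[Vv h]; rewrite /below /= dotBl subr_lt0 => vN; apply/chamberP; split=> // k.
by rewrite ltnS leq_eqVlt => /predU1P[->//|]; exact: h.
Qed.

(** The positions of the value of z among values q 0 < ... < q M. *)
Definition gap (q : nat -> 'rV[R]_d) z i : set 'rV[R]_d :=
  (if i is j.+1 then above (z - q j) else setT) `&` below (z - q i).

Lemma gapP q z i v : gap q z i v <->
  (forall j, j.+1 = i -> dot (q j) v < dot z v) /\ dot z v < dot (q i) v.
Proof.
rewrite /gap; case: i => [|i]; rewrite /setI /above /below /= !dotBl subr_lt0.
  by split=> -[].
by rewrite subr_gt0; split=> -[h1 h2]; split=> //; [move=> j [->] | exact: h1].
Qed.

(** The value of z passes from one position to the next through a point where it
    agrees with some q j, and no two of these coincidences happen at the same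
    point of K. So each hyperplane z = q j that meets K adds one position to
    those taken by z, and K itself, cut off at q M, accounts for the first. *)
Lemma sum_gap V K (q : nat -> 'rV[R]_d) z M : subspace V -> open_convex V K ->
  (forall v k, K v -> (k < M)%N -> dot (q k) v < dot (q k.+1) v) ->
  (forall k, (k < M)%N -> exists2 v, V v & dot (z - q k) v != 0) ->
  (\sum_(i < M.+1) nonempty (K `&` gap q z i) =
   nonempty (K `&` below (z - q M)) + \sum_(j < M) nonempty (K `&` perp (z - q j)))%N.
Proof.
move=> sV oK; elim: M => [|M ih] qK zV.
  by rewrite big_ord_recr !big_ord0 /= addn0 add0n /gap setTI.
(* The last gap is cut off below q M.+1, where the cut by z = q M applies. *)
rewrite big_ord_recr ih /=; last 2 first.
- by move=> v k Kv kM; apply: qK => //; exact: ltnW.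
- by move=> k kM; apply: zV; exact: ltnW.
rewrite big_ord_recr /= addnAC [RHS]addnA [RHS]addnAC; congr (_ + _)%N.
pose K' := K `&` below (z - q M.+1).
have := cut sV (open_convex_lt0 (z - q M.+1) oK) (zV M (ltnSn _)).
rewrite -/K' => cutK.
have -> : K `&` below (z - q M) = K' `&` below (z - q M).
  apply/seteqP; split=> v [Kv]; rewrite /below /= !dotBl !subr_lt0 => h.
    by split=> //; split=> //; rewrite /below /= dotBl subr_lt0 (lt_trans h)// qK.
  by split=> //; case: Kv.
have -> : K `&` gap q z M.+1 = K' `&` above (z - q M).
  by rewrite /gap /K' (setIC (above _)) setIA.
rewrite cutK; congr (_ + nonempty _)%N.
apply/seteqP; split=> v [Kv h]; split=> //; first by case: Kv.
split=> //; rewrite /below /= dotBl subr_lt0.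
by move: h => /eqP; rewrite dotBl subr_eq0 => /eqP->; rewrite qK.
Qed.

(** Inserting a vector into a chain constrains nothing but its own position. The
    second case is the last position in type A, which has no upper bound. *)
Lemma chamber_insert V N n (p : 'I_n.+1 -> 'rV[R]_d) (i : 'I_n.+1) : (i <= N.+1)%N ->
  chamber V N.+1 p = chamber V N (p \o lift i) `&`
    if (i <= N)%N then gap (extend (p \o lift i)) (p i) i
    else above (p i - extend (p \o lift i) N).
Proof.
move=> iN; have bl k : (k < i)%N -> extend (p \o lift i) k = extend p k.
  by move=> ki; rewrite extend_lift /bump leqNgt ki.
have br k : (i <= k)%N -> extend (p \o lift i) k = extend p k.+1.
  by move=> ik; rewrite extend_lift /bump ik.
apply/seteqP; split=> v.
  move=> vc; have mono := chamber_mono vc; split.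
    apply/chamberP; split; first by case/chamberP: vc.
    move=> k kN; rewrite !extend_lift; apply: mono; rewrite /bump; lia.
  case: ifP => iN'.
    apply/gapP; split=> [j ji|]; last by rewrite br// -extend_ord mono.
    by rewrite bl -?ji// -extend_ord mono -?ji// ji.
  have -> : N = i.-1 by lia.
  have i0 : (0 < i)%N by lia.
  by rewrite /above /= dotBl subr_gt0 bl ?prednK// -extend_ord mono// ?prednK.
move=> [/chamberP[Vv h] g]; apply/chamberP; split=> // k kN.
have [ki|ki|ki] := ltngtP k.+1 i.
- rewrite -!bl ?(ltnW ki)//; apply: h; lia.
- have ik : (i <= k)%N by lia.
  move: ik; rewrite leq_eqVlt => /predU1P[ik|ik].
    move: g; rewrite -ik (_ : (i <= N)%N); last by lia.
    by move=> /gapP[_]; rewrite extend_ord br.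
  have -> : k = k.-1.+1 by lia.
  rewrite -!br; [apply: h; lia|lia|lia].
rewrite ki extend_ord -bl; last by lia.
move: g; case: ifP => iN'.
  by move=> /gapP[/(_ _ ki)].
have -> : k = N by lia.
by rewrite /above /= dotBl subr_gt0.
Qed.

End Chains.

(** * Sums over permutations and over signed permutations *)

Lemma lift_perm_bij n (i : 'I_n.+1) :
  bijective (fun bs : 'I_n.+1 * 'S_n => lift_perm i bs.1 bs.2).
Proof.
apply: inj_card_bij => [[b s] [b' s'] /= e|].
  have bb : b = b' by rewrite -(lift_perm_id i b s) e lift_perm_id.
  rewrite -bb in e *; congr pair; apply/permP => k; apply: (@lift_inj _ b).
  by rewrite -!(lift_perm_lift i) e.
by rewrite card_prod card_ord !card_Sn factS.
Qed.

Lemma sum_perm_pos n (i : 'I_n.+1) (F : 'S_n.+1 -> nat) :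
  (\sum_s F s = \sum_b \sum_s F (lift_perm i b s))%N.
Proof.
by rewrite pair_big /= (reindex _ (onW_bij _ (lift_perm_bij i))).
Qed.

Lemma sum_perm_val n (b : 'I_n.+1) (F : 'S_n.+1 -> nat) :
  (\sum_s F s = \sum_i \sum_s F (lift_perm i b s))%N.
Proof.
rewrite (reindex_inj invg_inj) (sum_perm_pos b); apply: eq_bigr => i _.
by rewrite (reindex_inj invg_inj); apply: eq_bigr => s _; rewrite lift_permV invgK.
Qed.

Definition insert_sign n (i : 'I_n.+1) (t : bool) (e : {ffun 'I_n -> bool}) :
    {ffun 'I_n.+1 -> bool} :=
  [ffun j => oapp e t (unlift i j)].

Lemma insert_sign_bij n (i : 'I_n.+1) :
  bijective (fun te : bool * {ffun 'I_n -> bool} => insert_sign i te.1 te.2).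
Proof.
apply: inj_card_bij => [[t e] [t' e'] /= /ffunP ee|].
  congr pair; first by have := ee i; rewrite !ffunE unlift_none.
  by apply/ffunP => k; have := ee (lift i k); rewrite !ffunE liftK.
by rewrite card_prod !card_ffun !card_ord card_bool expnS.
Qed.

Lemma sum_insert_sign n (i : 'I_n.+1) (F : {ffun 'I_n.+1 -> bool} -> nat) :
  (\sum_e F e = \sum_t \sum_e F (insert_sign i t e))%N.
Proof. by rewrite pair_big /= (reindex _ (onW_bij _ (insert_sign_bij i))). Qed.

(** * Totals over permutations *)

Section Totals.
Variables (R : realType) (d : nat).
Implicit Types V : set 'rV[R]_d.

Lemma lift_perm_comp n (y : 'I_n.+1 -> 'rV[R]_d) i b s :
  (y \o lift_perm i b s) \o lift i = (y \o lift b) \o s.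
Proof. by apply/funext => k; rewrite /= lift_perm_lift. Qed.

Lemma signed_perm_insert n (y : 'I_n.+1 -> 'rV[R]_d) i b t e s :
  signed_perm (insert_sign i t e) (lift_perm i b s) y \o lift i =
  signed_perm e s (y \o lift b).
Proof.
by apply/funext => k; rewrite /signed_perm /= ffunE liftK lift_perm_lift.
Qed.

Lemma signed_perm_insert_id n (y : 'I_n.+1 -> 'rV[R]_d) i b t e s :
  signed_perm (insert_sign i t e) (lift_perm i b s) y i = (-1) ^+ t *: y b.
Proof. by rewrite /signed_perm /= ffunE unlift_none lift_perm_id. Qed.

Lemma perpN (u : 'rV[R]_d) : perp (- u) = perp u.
Proof.
by apply: eq_set => v; rewrite dotNl; apply/propext; split=> /eqP;
   rewrite ?oppr_eq0 => /eqP // ->; rewrite oppr0.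
Qed.

Lemma perp_sign (b : bool) (u : 'rV[R]_d) : perp ((-1) ^+ b *: u) = perp u.
Proof. by case: b; rewrite ?scale1r// scaleN1r perpN. Qed.

Lemma perp_mirror (u w : 'rV[R]_d) (a b : bool) :
  perp ((-1) ^+ a *: u - (-1) ^+ b *: w) = perp (u - (-1) ^+ (a (+) b) *: w).
Proof.
rewrite -(perp_sign a) scalerBr !scalerA -!signr_addb addbb scale1r.
by [].
Qed.

(** A hyperplane ignores the sign of its normal vector, so that only the relative
    sign of u and y matters; as both relative signs are summed over, the signs
    and the order of the sequence can be absorbed. *)
Lemma sum_mirror n (y : 'I_n -> 'rV[R]_d) (e : 'I_n -> bool) (s : 'S_n) u
    (G : set 'rV[R]_d -> nat) :
  (\sum_(t : bool) \sum_(j < n) G (perp ((-1) ^+ t *: u - signed_perm e s y j)) =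
   \sum_(t : bool) \sum_(a < n) G (perp (u - (-1) ^+ t *: y a)))%N.
Proof.
rewrite exchange_big [RHS]exchange_big /= [RHS](reindex_inj (@perm_inj _ s)).
apply: eq_bigr => j _; rewrite /signed_perm.
rewrite [RHS](reindex_inj (@addIb (e j))); apply: eq_bigr => t _.
by rewrite perp_mirror.
Qed.

Definition totalA k n V (y : 'I_n.+1 -> 'rV[R]_d) : nat :=
  \sum_(s : 'S_n.+1) fcount k V (chain (y \o s) : 'I_n -> _).

Definition genericA e n V (y : 'I_n.+1 -> 'rV[R]_d) : Prop :=
  forall s : 'S_n.+1, generic e V (chain (y \o s) : 'I_n -> _).

(** A chain of the remaining points is the chain with b put in front, without its
    first difference. *)
Lemma genericA_delete e n V (y : 'I_n.+2 -> 'rV[R]_d) b :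
  genericA e V y -> genericA e V (y \o lift b).
Proof.
move=> g s; rewrite -(lift_perm_comp y ord0 b s).
exact: generic_chain_delete (g (lift_perm ord0 b s)).
Qed.

Lemma chain_inserted n (y : 'I_n.+2 -> 'rV[R]_d) b (s : 'S_n.+1) (l : 'I_n.+1) :
  let l' := widen_ord (leqnSn n.+1) l in let p := y \o lift_perm l' b s in
  p l' - extend (p \o lift l') l = y b - y (lift b (s l)).
Proof. by rewrite /= lift_perm_id lift_perm_comp extend_ord. Qed.

(** A chain of the remaining points becomes, on the mirror where b and a agree, the
    chain in which b is put right before a, contracted at their difference. *)
Lemma genericA_contract e n V (y : 'I_n.+2 -> 'rV[R]_d) b a :
  genericA e.+1 V y ->
  genericA e (V `&` perp (y b - y (lift b a))) (y \o lift b).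
Proof.
move=> g s; pose l := (s^-1)%g a; pose l' := widen_ord (leqnSn n.+1) l.
have := @generic_chain_contract _ _ e n _ V _ l l' erefl (g (lift_perm l' b s)).
by rewrite chain_inserted permKV lift_perm_comp.
Qed.

Lemma genericA_mirror e n V (y : 'I_n.+2 -> 'rV[R]_d) b a : genericA e.+1 V y ->
  exists2 v, V v & dot (y b - y (lift b a)) v != 0.
Proof.
move=> g; pose s : 'S_n.+1 := 1%g; pose l' := widen_ord (leqnSn n.+1) a.
have [+ _] := g (lift_perm l' b s) => /(_ finset.set0).
rewrite cards0 => /(_ isT a); rewrite inE => /(_ isT)[v [Vv _ va]].
exists v => //; move: va.
by rewrite (@chain_at _ _ _ _ _ _ l')// chain_inserted perm1.
Qed.

(** Choosing one of the k+1 equalities in a chain amounts to choosing an ordered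
    pair of points b, a that are adjacent and agree; removing b leaves a chain
    with k equalities in the mirror of b and a. *)
Lemma totalA_contract k n V (y : 'I_n.+2 -> 'rV[R]_d) :
  (k.+1 * totalA k.+1 V y =
   \sum_b \sum_a totalA k (V `&` perp (y b - y (lift b a))) (y \o lift b))%N.
Proof.
rewrite /totalA big_distrr /=.
under eq_bigr do rewrite fcount_contract.
rewrite exchange_big /=.
transitivity (\sum_(l < n.+1) \sum_b \sum_(s : 'S_n.+1)
    fcount k (V `&` perp (y b - y (lift b (s l)))) (chain ((y \o lift b) \o s) : 'I_n -> _))%N.
  apply: eq_bigr => l _; rewrite (sum_perm_pos (widen_ord (leqnSn n.+1) l)).
  apply: eq_bigr => b _; apply: eq_bigr => s _.
  rewrite (@fcount_chain_contract _ _ _ _ _ _ _ _ (widen_ord (leqnSn n.+1) l))//.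
  by rewrite chain_inserted lift_perm_comp.
rewrite exchange_big /=; apply: eq_bigr => b _.
rewrite exchange_big [RHS]exchange_big; apply: eq_bigr => s _ /=.
by rewrite [RHS](reindex_inj (@perm_inj _ s)).
Qed.

(** Deletion and restriction: the chambers of the remaining points are subdivided
    by the mirrors of b, and each mirror adds as many pieces as it meets
    chambers. *)
Lemma totalA0_insert e n V (y : 'I_n.+2 -> 'rV[R]_d) b :
  subspace V -> genericA e.+1 V y ->
  (totalA 0 V y = totalA 0 V (y \o lift b) +
   \sum_a totalA 0 (V `&` perp (y b - y (lift b a))) (y \o lift b))%N.
Proof.
move=> sV g; rewrite /totalA (sum_perm_val b) exchange_big /=.
rewrite [X in (_ + X)%N]exchange_big -big_split /=; apply: eq_bigr => s _.
set p' := (y \o lift b) \o s; set K := chamber V n p'.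
have oK : open_convex V K by exact: open_convex_chamber.
have mirror j (jn : (j < n.+1)%N) : y b - extend p' j = y b - y (lift b (s (Ordinal jn))).
  by rewrite -[j]/(val (Ordinal jn)) extend_ord.
have zV j : (j < n.+1)%N -> exists2 v, V v & dot (y b - extend p' j) v != 0.
  by move=> jn; rewrite (mirror _ jn); exact: genericA_mirror g.
transitivity (\sum_(i < n.+1) nonempty (K `&` gap (extend p') (y b) i) +
    nonempty (K `&` above (y b - extend p' n)))%N.
  rewrite big_ord_recr /=; congr (_ + _)%N.
    apply: eq_bigr => i _; rewrite fcount0 -/(chamber V n.+1 _).
    rewrite (@chamber_insert _ _ _ _ _ _ (widen_ord (leqnSn n.+1) i)); last exact: ltnW (ltn_ord i).
    by rewrite lift_perm_comp /= lift_perm_id -ltnS ltn_ord.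
  rewrite fcount0 -/(chamber V n.+1 _) (@chamber_insert _ _ _ _ _ _ ord_max)//.
  by rewrite lift_perm_comp /= ltnn lift_perm_id.
rewrite (sum_gap sV oK); last 2 first.
- by move=> v k /chamberP[_]; exact.
- by move=> k kn; apply: zV; exact: ltnW.
rewrite addnAC (cut sV oK); last exact: zV.
rewrite fcount0 -/(chamber V n _) -/K -addnA; congr (_ + _)%N.
rewrite (reindex_inj (@perm_inj _ s)) big_ord_recr /= addnC.
have step j (jn : (j < n.+1)%N) i : i = Ordinal jn ->
    nonempty (K `&` perp (y b - extend p' j)) =
    fcount 0 (V `&` perp (y b - y (lift b (s i)))) (chain p' : 'I_n -> _).
  move=> ->; rewrite (mirror _ jn) fcount0; congr nonempty.
  by apply/seteqP; split=> v; rewrite /K /chamber /cell /= => -[[]].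
congr (_ + _)%N; last by apply: (step _ (ltnSn n)); exact: val_inj.
apply: eq_bigr => j _; apply: (step _ (ltnW (ltn_ord j) : (j < n.+1)%N)).
exact: val_inj.
Qed.

End Totals.

(** * Totals over signed permutations *)

Section TotalsB.
Variables (R : realType) (d : nat).
Implicit Types (V : set 'rV[R]_d) (r : bool).

Definition totalB k n V (y : 'I_n -> 'rV[R]_d) : nat :=
  \sum_(e : {ffun 'I_n -> bool}) \sum_(s : 'S_n)
    fcount k V (chain (signed_perm e s y) : 'I_n -> _).

Definition genericB e n V (y : 'I_n -> 'rV[R]_d) : Prop :=
  forall (t : {ffun 'I_n -> bool}) (s : 'S_n),
    generic e V (chain (signed_perm t s y) : 'I_n -> _).

Lemma genericB_delete e n V (y : 'I_n.+1 -> 'rV[R]_d) b :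
  genericB e V y -> genericB e V (y \o lift b).
Proof.
move=> g t s; rewrite -(signed_perm_insert y ord0 b false).
exact: generic_chain_delete.
Qed.

(** The point b is put at the end of the chain, with which zero is compared. *)
Lemma genericB_contract0 e n V (y : 'I_n.+1 -> 'rV[R]_d) b :
  genericB e.+1 V y -> genericB e (V `&` perp (y b)) (y \o lift b).
Proof.
move=> g t s.
have := @generic_chain_contract _ _ e n _ V _ ord_max ord_max erefl
  (g (insert_sign ord_max false t) (lift_perm ord_max b s)).
by rewrite signed_perm_insert_id signed_perm_insert extend_out// subr0 perp_sign.
Qed.

Lemma genericB_contract e n V (y : 'I_n.+1 -> 'rV[R]_d) b r a :
  genericB e.+1 V y ->
  genericB e (V `&` perp (y b - (-1) ^+ r *: y (lift b a))) (y \o lift b).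
Proof.
move=> g t s; pose j := (s^-1)%g a; pose l := widen_ord (leqnSn n) j.
have := @generic_chain_contract _ _ e n _ V _ l l erefl
  (g (insert_sign l (r (+) t j) t) (lift_perm l b s)).
rewrite signed_perm_insert_id signed_perm_insert (extend_ord _ j) /signed_perm /=.
by rewrite perp_mirror addbK permKV.
Qed.

Lemma genericB_mirror0 e n V (y : 'I_n.+1 -> 'rV[R]_d) b : genericB e.+1 V y ->
  exists2 v, V v & dot (y b) v != 0.
Proof.
move=> g; pose s : 'S_n := 1%g; pose t : {ffun 'I_n -> bool} := [ffun=> false].
have [+ _] := g (insert_sign ord_max false t) (lift_perm ord_max b s) => /(_ finset.set0).
rewrite cards0 => /(_ isT ord_max); rewrite inE => /(_ isT)[v [Vv _ va]].
exists v => //; move: va.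
by rewrite (@chain_at _ _ _ _ _ _ ord_max)// signed_perm_insert_id extend_out// subr0 scale1r.
Qed.

Lemma genericB_mirror e n V (y : 'I_n.+1 -> 'rV[R]_d) b r a : genericB e.+1 V y ->
  exists2 v, V v & dot (y b - (-1) ^+ r *: y (lift b a)) v != 0.
Proof.
move=> g; pose s : 'S_n := 1%g; pose t : {ffun 'I_n -> bool} := [ffun=> r].
pose l := widen_ord (leqnSn n) a.
have [+ _] := g (insert_sign l false t) (lift_perm l b s) => /(_ finset.set0).
rewrite cards0 => /(_ isT l); rewrite inE => /(_ isT)[v [Vv _ va]].
exists v => //; move: va.
rewrite (@chain_at _ _ _ _ _ _ l)// signed_perm_insert_id signed_perm_insert.
by rewrite (extend_ord _ a) /signed_perm /= ffunE perm1 scale1r.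
Qed.

(** As in type A, except that b can agree with a or with its opposite, or be zero
    at the end of the chain. The last case is met twice, once for each sign of
    b. *)
Lemma totalB_contract k n V (y : 'I_n.+1 -> 'rV[R]_d) :
  (k.+1 * totalB k.+1 V y =
   \sum_b \sum_(r : bool)
     (totalB k (V `&` perp (y b)) (y \o lift b) +
      \sum_a totalB k (V `&` perp (y b - (-1) ^+ r *: y (lift b a))) (y \o lift b)))%N.
Proof.
rewrite /totalB big_distrr /=.
under [LHS]eq_bigr do rewrite big_distrr /=.
under [LHS]eq_bigr do under eq_bigr do rewrite fcount_contract.
under [LHS]eq_bigr do rewrite exchange_big /=.
rewrite exchange_big /=.
pose F l (r : bool) b (t : {ffun 'I_n -> bool}) (s : 'S_n) :=
  let p := signed_perm t s (y \o lift b) in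
  fcount k (V `&` perp ((-1) ^+ r *: y b - extend p l)) (chain p : 'I_n -> _).
transitivity (\sum_(l < n.+1) \sum_(r : bool) \sum_t \sum_b \sum_s F l r b t s)%N.
  apply: eq_bigr => l _; rewrite (sum_insert_sign l).
  apply: eq_bigr => r _; apply: eq_bigr => t _; rewrite (sum_perm_pos l).
  apply: eq_bigr => b _; apply: eq_bigr => s _.
  by rewrite (@fcount_chain_contract _ _ _ _ _ _ _ _ l)// signed_perm_insert_id signed_perm_insert.
transitivity (\sum_b \sum_t \sum_s \sum_(l < n.+1) \sum_(r : bool) F l r b t s)%N.
  under [LHS]eq_bigr do under eq_bigr do rewrite exchange_big /=.
  under [LHS]eq_bigr do rewrite exchange_big /=.
  rewrite exchange_big /=; apply: eq_bigr => b _.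
  under [LHS]eq_bigr do rewrite exchange_big /=.
  rewrite exchange_big /=; apply: eq_bigr => t _.
  under [LHS]eq_bigr do rewrite exchange_big /=.
  by rewrite exchange_big.
apply: eq_bigr => b _.
pose G (t : {ffun 'I_n -> bool}) (s : 'S_n) (H : set 'rV[R]_d) :=
  fcount k (V `&` H) (chain (signed_perm t s (y \o lift b)) : 'I_n -> _).
transitivity (\sum_t \sum_s \sum_(r : bool) (G t s (perp (y b)) +
    \sum_a G t s (perp (y b - (-1) ^+ r *: y (lift b a)))))%N.
  apply: eq_bigr => t _; apply: eq_bigr => s _; rewrite exchange_big /=.
  under [LHS]eq_bigr do rewrite big_ord_recr /=.
  rewrite !big_split /= addnC; congr (_ + _)%N.
    apply: eq_bigr => r _; rewrite /F extend_out// subr0 perp_sign.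
    by [].
  rewrite -[RHS](sum_mirror _ t s (y b) (G t s)).
  by apply: eq_bigr => r _; apply: eq_bigr => j _; rewrite /F /G extend_ord.
under [LHS]eq_bigr do rewrite exchange_big /=.
rewrite exchange_big /=; apply: eq_bigr => r _.
under [LHS]eq_bigr do rewrite big_split /=.
rewrite big_split /=; congr (_ + _)%N.
under [LHS]eq_bigr do rewrite exchange_big /=.
by rewrite exchange_big.
Qed.

(** Positions below zero are taken by b on one side of its mirror and by its
    opposite on the other; together the two sides account for the whole chamber
    and for its trace on the mirror. *)
Lemma totalB0_insert e n V (y : 'I_n.+1 -> 'rV[R]_d) b :
  subspace V -> genericB e.+1 V y ->
  (totalB 0 V y = totalB 0 V (y \o lift b) +
   (totalB 0 (V `&` perp (y b)) (y \o lift b) +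
    \sum_(r : bool) \sum_a
       totalB 0 (V `&` perp (y b - (-1) ^+ r *: y (lift b a))) (y \o lift b)))%N.
Proof.
move=> sV g; rewrite /totalB.
pose K (t : {ffun 'I_n -> bool}) (s : 'S_n) := chamber V n (signed_perm t s (y \o lift b)).
pose F (i : 'I_n.+1) (r : bool) (t : {ffun 'I_n -> bool}) (s : 'S_n) :=
  let p := signed_perm t s (y \o lift b) in
  nonempty (K t s `&` gap (extend p) ((-1) ^+ r *: y b) i).
transitivity (\sum_t \sum_s \sum_(r : bool) \sum_i F i r t s)%N.
  transitivity (\sum_i \sum_(r : bool) \sum_t \sum_s F i r t s)%N.
    rewrite exchange_big (sum_perm_val b) /=; apply: eq_bigr => i _.
    rewrite exchange_big (sum_insert_sign i) /=; apply: eq_bigr => r _.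
    apply: eq_bigr => t _; apply: eq_bigr => s _.
    rewrite fcount0 -/(chamber V n.+1 _).
    rewrite (@chamber_insert _ _ _ _ _ _ i); last exact: ltnW (ltn_ord i).
    by rewrite signed_perm_insert signed_perm_insert_id -ltnS ltn_ord.
  under [LHS]eq_bigr do rewrite exchange_big /=.
  rewrite exchange_big /=; apply: eq_bigr => t _.
  under [LHS]eq_bigr do rewrite exchange_big /=.
  rewrite exchange_big /=; apply: eq_bigr => s _.
  by rewrite exchange_big.
pose G (t : {ffun 'I_n -> bool}) (s : 'S_n) (H : set 'rV[R]_d) := nonempty (K t s `&` H).
have GE t s H : G t s H =
    fcount 0 (V `&` H) (chain (signed_perm t s (y \o lift b)) : 'I_n -> _).
  rewrite fcount0; congr nonempty.
  by apply/seteqP; split=> v; rewrite /K /chamber /cell /= => -[[]].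
transitivity (\sum_t \sum_s (nonempty (K t s) + (G t s (perp (y b)) +
    \sum_(r : bool) \sum_a G t s (perp (y b - (-1) ^+ r *: y (lift b a))))))%N.
  apply: eq_bigr => t _; apply: eq_bigr => s _.
  set p := signed_perm t s (y \o lift b).
  have oK : open_convex V (K t s) by exact: open_convex_chamber.
  have zV (r : bool) j : (j < n)%N ->
      exists2 v, V v & dot ((-1) ^+ r *: y b - extend p j) v != 0.
    move=> jn; rewrite -[j]/(val (Ordinal jn)) extend_ord /p /signed_perm /=.
    have [v Vv] := genericB_mirror b (r (+) t (Ordinal jn)) (s (Ordinal jn)) g.
    move=> vn; exists v => //; apply: contra vn => /eqP vp.
    have : perp ((-1) ^+ r *: y b - (-1) ^+ t (Ordinal jn) *: y (lift b (s (Ordinal jn)))) v by [].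
    by rewrite perp_mirror => ->.
  transitivity (\sum_(r : bool) (nonempty (K t s `&` below ((-1) ^+ r *: y b)) +
      \sum_(j < n) G t s (perp ((-1) ^+ r *: y b - p j))))%N.
    apply: eq_bigr => r _; rewrite /F (sum_gap sV oK) ?extend_out ?subr0//; last 2 first.
    - by move=> v k /chamberP[_]; exact.
    - exact: zV.
    by congr (_ + _)%N; apply: eq_bigr => j _; rewrite extend_ord.
  rewrite big_split /= (sum_mirror _ t s (y b) (G t s)) addnA; congr (_ + _)%N.
  rewrite big_bool /= addnC expr0 scale1r expr1 scaleN1r.
  rewrite (_ : below (- y b) = above (y b)).
    by rewrite (cut sV oK)//; exact: genericB_mirror0 g.
  by apply: eq_set => v; rewrite dotNl oppr_lt0.
under [LHS]eq_bigr do rewrite !big_split /=.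
rewrite !big_split /=; congr (_ + (_ + _))%N.
- by apply: eq_bigr => t _; apply: eq_bigr => s _; rewrite fcount0.
- by apply: eq_bigr => t _; apply: eq_bigr => s _; rewrite GE.
under [LHS]eq_bigr do rewrite exchange_big /=.
rewrite exchange_big /=; apply: eq_bigr => r _.
under [LHS]eq_bigr do rewrite exchange_big /=.
rewrite exchange_big /=; apply: eq_bigr => a _.
by apply: eq_bigr => t _; apply: eq_bigr => s _; rewrite GE.
Qed.

End TotalsB.

(** * The values of the totals *)

(** The number of chambers that a linear subspace of dimension e in general position
    meets in an arrangement built up in n steps, the m-th of which adds b m
    hyperplanes whose pairwise intersections lie in earlier ones. *)
Fixpoint chambers (b : nat -> nat) n e : nat :=
  match n, e with
  | 0, _ => 1
  | _.+1, 0 => 0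
  | m.+1, e'.+1 => chambers b m e + b m * chambers b m e'
  end.

Lemma chambers_gt0 b n e : (0 < chambers b n e.+1)%N.
Proof. by elim: n => // n ih /=; rewrite ltn_addr. Qed.

Section Values.
Variables (R : realType) (d : nat).
Implicit Types V : set 'rV[R]_d.

Lemma cell_generic0 N V (x : 'I_N.+1 -> 'rV[R]_d) :
  generic 0 V x -> cell V x finset.set0 = set0.
Proof.
move=> [_ g]; apply/seteqP; split=> // v [Vv /(_ ord0)].
by rewrite inE (g finset.set0)// ?ltxx// => i; rewrite inE.
Qed.

Lemma cell_nil V (x : 'I_0 -> 'rV[R]_d) J : cell V x J = V.
Proof. by apply/seteqP; split=> v => [[]//|Vv]; split=> // -[]. Qed.

Lemma totalA0E e n V (y : 'I_n.+1 -> 'rV[R]_d) : subspace V -> genericA e V y ->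
  totalA 0 V y = chambers succn n e.
Proof.
elim: n e V y => [|n ih] e V y sV g.
  rewrite /totalA (big_pred1 1%g) => [|s]; last first.
    by apply/esym/eqP/permP => i; rewrite !ord1.
  rewrite fcount0 cell_nil (@nonempty1 _ _ _ 0)//; by case: sV.
case: e g => [|e] g.
  by rewrite /totalA big1// => s _; rewrite fcount0 (cell_generic0 (g s)) nonempty0 // => v [].
rewrite (totalA0_insert ord0 sV g) (ih e.+1)//; last exact: genericA_delete.
rewrite (eq_bigr (fun=> chambers succn n e)).
  by rewrite sum_nat_const card_ord.
by move=> a _; apply: ih; [exact: subspace_perp | exact: genericA_contract].
Qed.

Lemma totalB0E e n V (y : 'I_n -> 'rV[R]_d) : subspace V -> genericB e V y ->
  totalB 0 V y = chambers (fun m => m.*2.+1) n e.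
Proof.
elim: n e V y => [|n ih] e V y sV g.
  rewrite /totalB (big_pred1 [ffun=> false]) => [|t]; last first.
    by apply/esym/eqP/ffunP => -[].
  rewrite (big_pred1 1%g) => [|s]; last by apply/esym/eqP/permP => -[].
  rewrite fcount0 cell_nil (@nonempty1 _ _ _ 0)//; by case: sV.
case: e g => [|e] g.
  rewrite /totalB big1// => t _; rewrite big1// => s _.
  by rewrite fcount0 (cell_generic0 (g t s)) nonempty0 // => v [].
rewrite (totalB0_insert ord0 sV g) (ih e.+1)//; last exact: genericB_delete.
rewrite (ih e); [|exact: subspace_perp|exact: genericB_contract0].
rewrite (eq_bigr (fun=> n * chambers (fun m => m.*2.+1) n e)%N).
  rewrite sum_nat_const card_bool /=; lia.
move=> r _; rewrite (eq_bigr (fun=> chambers (fun m => m.*2.+1) n e)).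
  by rewrite sum_nat_const card_ord.
by move=> a _; apply: ih; [exact: subspace_perp | exact: genericB_contract].
Qed.

(** Contracting k times leads to the chambers of n+1-k points in dimension e-k. The
    factor beside their number counts the permutations with k marked adjacencies,
    up to the order of the n+1-k blocks so obtained. *)
Lemma totalAE k e n V (y : 'I_n.+1 -> 'rV[R]_d) :
  (k <= e)%N -> (k <= n)%N -> subspace V -> genericA e V y ->
  (totalA k V y * (n.+1 - k)`! = 'C(n, k) * n.+1`! * chambers succn (n - k) (e - k))%N.
Proof.
elim: k e n V y => [|k ih] e n V y.
  by move=> _ _ sV g; rewrite !subn0 bin0 mul1n (totalA0E sV g) mulnC.
case: e n y => // e [//|n] y; rewrite !ltnS => ke kn sV g.
apply/eqP; rewrite -(eqn_pmul2l (ltn0Sn k)) mulnA totalA_contract.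
rewrite big_distrl /= (eq_bigr (fun=> \sum_(a < n.+1)
    ('C(n, k) * n.+1`! * chambers succn (n - k) (e - k)))%N); last first.
  move=> b _; rewrite big_distrl; apply: eq_bigr => a _ /=; rewrite subSS.
  by apply: ih => //; [exact: subspace_perp | exact: genericA_contract].
rewrite !sum_nat_const !card_ord !subSS (factS n.+1).
have := mul_bin_diag n.+1 k; rewrite /= => h.
set C := chambers _ _ _; set f := n.+1`!.
apply/eqP; transitivity (n.+1 * 'C(n, k) * n.+2 * f * C)%N; first by ring.
by rewrite h; ring.
Qed.

(** Here a block can also be replaced by its opposite, and the last one may be a
    block of zeros. *)
Lemma totalBE k e n V (y : 'I_n -> 'rV[R]_d) :
  (k <= e)%N -> (k <= n)%N -> subspace V -> genericB e V y ->
  (totalB k V y * (n - k)`! =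
   2 ^ k * 'C(n, k) * n`! * chambers (fun m => m.*2.+1) (n - k) (e - k))%N.
Proof.
elim: k e n V y => [|k ih] e n V y.
  by move=> _ _ sV g; rewrite !subn0 bin0 mul1n (totalB0E sV g) mulnC.
case: e n y => // e [//|n] y; rewrite !ltnS => ke kn sV g.
apply/eqP; rewrite -(eqn_pmul2l (ltn0Sn k)) mulnA totalB_contract.
set c := (2 ^ k * 'C(n, k) * n`! * chambers (fun m => m.*2.+1) (n - k) (e - k))%N.
rewrite big_distrl /= (eq_bigr (fun=> 2 * (n.+1 * c))%N); last first.
  move=> b _; rewrite big_distrl (eq_bigr (fun=> n.+1 * c)%N).
    by rewrite sum_nat_const card_bool.
  move=> r _ /=; rewrite subSS mulnDl.
  rewrite (ih e); [|by []|by []|exact: subspace_perp|exact: genericB_contract0].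
  rewrite big_distrl (eq_bigr (fun=> c)) ?sum_nat_const ?card_ord//.
  by move=> a _; apply: ih => //; [exact: subspace_perp | exact: genericB_contract].
rewrite sum_nat_const card_ord !subSS /c factS expnS.
have := mul_bin_diag n.+1 k; rewrite /= => h.
set C := chambers _ _ _; set f := n`!; set q := (2 ^ k)%N.
apply/eqP; transitivity (2 * q * (n.+1 * 'C(n, k)) * (n.+1 * f) * C)%N; first by ring.
by rewrite h; ring.
Qed.

End Values.

(** * The numbers DA and DB *)

Section Numbers.
Variable b : nat -> nat.

Definition coefs n k : nat := ((\prod_(i < n) ('X + (b i)%:P) : {poly nat})`_k)%R.

Lemma coefs0 k : coefs 0 k = (k == 0)%N.
Proof. by rewrite /coefs big_ord0 coef1; case: (k == 0)%N. Qed.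

Lemma coefsS n k :
  coefs n.+1 k = (b n * coefs n k + (0 < k) * coefs n k.-1)%N.
Proof.
rewrite /coefs big_ord_recr /= mulrDr coefD coefMX coefMC.
by case: k => [|k] /=; rewrite addrC [in LHS]mulrC ?mul1n.
Qed.

Lemma coefs_out n k : (n < k)%N -> coefs n k = 0%N.
Proof.
elim: n k => [|n ih] [|k] // nk; first by rewrite coefs0.
by rewrite coefsS !ih ?muln0 // ltnW.
Qed.

(** The common form of DA and DB, for b i = i and for b i = 2 i + 1. *)
Definition Dsum m k : nat :=
  (2 * \sum_(i < k.+1 | k <= m + 1 + i.*2) coefs m (m + 1 + i.*2 - k))%N.

Lemma Dsum_e0 m : Dsum m 0 = 0%N.
Proof.
rewrite /Dsum big1 // => i _; rewrite subn0 coefs_out //; lia.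
Qed.

Lemma Dsum_m0 k : Dsum 0 k = (2 * odd k)%N.
Proof.
rewrite /Dsum; congr (2 * _)%N; have [kodd|keven] := boolP (odd k).
  (* The only index that gives the coefficient of degree 0 is i = k./2. *)
  have hk : (k./2 < k.+1)%N by lia.
  rewrite (bigD1 (Ordinal hk)) /=; last by lia.
  rewrite big1 ?addn0 => [|i /andP[ki /eqP ik]]; first by rewrite coefs0; lia.
  have : i <> k./2 :> nat by move=> h; apply: ik; exact: val_inj.
  rewrite coefs0; lia.
by rewrite big1 // => i ki; rewrite coefs0; lia.
Qed.

(** The recursion of the coefficients; the ranges of summation of the two sides
    differ by indices at which the coefficients vanish. *)
Lemma DsumS m k : Dsum m.+1 k.+1 = (Dsum m k.+1 + b m * Dsum m k)%N.
Proof.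
rewrite /Dsum mulnCA -mulnDr; congr (2 * _)%N.
rewrite (eq_bigl (fun i : 'I_k.+2 => k <= m + 1 + i.*2)%N); last first.
  by move=> i; rewrite addSn addSn ltnS.
under eq_bigr do rewrite coefsS.
rewrite big_split /= addnC; congr (_ + _)%N.
  rewrite big_mkcond [RHS]big_mkcond; apply: eq_bigr => i _.
  case: ifP => h1; case: ifP => h2 //; try lia.
  by rewrite (_ : (0 < _)%N) ?mul1n; [congr coefs|]; lia.
rewrite big_mkcond big_ord_recr /= -big_mkcond /= -big_distrr /=.
rewrite ifT; last by lia.
rewrite [X in (_ + _ * X)%N]coefs_out ?muln0 ?addn0; last by lia.
by congr (_ * _)%N; apply: eq_bigr => i _; congr coefs; lia.
Qed.

End Numbers.

(** The factor of index 0 is X and contributes no hyperplane, hence the shift. The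
    identity needs two points, since a single one has one chamber, whereas the
    sum is then 0 or 2. *)
Lemma DA_chambers n e : DA n.+2 e = chambers succn n.+1 e.
Proof.
have -> : DA n.+2 e = Dsum id n.+2 e.
  rewrite /DA /Dsum; congr (2 * _)%N; apply: eq_bigr => i _; rewrite /stirlingA.
  case: ifP => // h; have := coefs_out id (k := (n.+2 + 1 + i.*2 - e)%N) (n := n.+2).
  case: ltnP => [_ ->//|kn _]; have {h kn} -> : (n.+2 + 1 + i.*2 - e = 0)%N by lia.
  elim: n.+1 => [|m ih]; first by rewrite coefsS.
  by rewrite coefsS -ih muln0.
have D1 f : Dsum id 1 f = (2 * odd f)%N.
  by case: f => [|f]; rewrite ?Dsum_e0// DsumS Dsum_m0 mul0n addn0.
elim: n e => [|n ih] [|e]; rewrite ?Dsum_e0//.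
  by rewrite DsumS !D1 /= mul1n -mulnDr; case: (odd e).
by rewrite DsumS !ih.
Qed.

Lemma DB_chambers n e : DB n.+1 e = chambers (fun m => m.*2.+1) n.+1 e.
Proof.
have -> : DB n.+1 e = Dsum (fun m => m.*2.+1) n.+1 e by [].
elim: n e => [|n ih] [|e]; rewrite ?Dsum_e0//.
  by rewrite DsumS !Dsum_m0 /= mul1n -mulnDr; case: (odd e).
by rewrite DsumS !ih.
Qed.

(** * Positive hulls are intersections of half-spaces *)

Section Weyl.
Variables (R : realType) (d : nat).
Implicit Types (u v w : 'rV[R]_d).

Lemma dot_self_gt0 v : v != 0 -> 0 < dot v v.
Proof.
move=> v0; rewrite lt_neqAle eq_sym; apply/andP; split.
  apply: contra v0 => /eqP vv; apply/eqP/mulmx_tr_eq0.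
  by apply/matrixP => i j; rewrite !ord1 [RHS]mxE.
by rewrite /dot mxE sumr_ge0// => i _; rewrite mxE -expr2 sqr_ge0.
Qed.

Lemma max_spec (s : seq R) :
  exists t, [/\ 0 <= t, t = 0 \/ t \in s & forall r, r \in s -> r <= t].
Proof.
elim: s => [|a s [t [t0 ts st]]]; first by exists 0; split=> //; left.
have [ta|at_] := leP a t.
  exists t; split=> // [|r].
    by case: ts => ts; [left | right; rewrite in_cons ts orbT].
  by rewrite in_cons => /predU1P[->|/st].
exists a; split=> [||r]; first exact: le_trans (ltW at_).
  by right; rewrite mem_head.
by rewrite in_cons => /predU1P[->//|/st rt]; exact: le_trans (ltW at_).
Qed.

Lemma pos_recl N (x : 'I_N.+1 -> 'rV[R]_d) v :
  pos x v <-> exists2 t, 0 <= t & pos (x \o lift ord0) (v - t *: x ord0).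
Proof.
split=> [[l l0 ->]|[t t0 [l l0 h]]].
  exists (l ord0) => //; exists (l \o lift ord0) => [i|]; first exact: l0.
  by rewrite big_ord_recl addrC addKr.
exists (fun i => oapp l t (unlift ord0 i)) => [i|].
  by case: unliftP => [j _|_] /=.
rewrite big_ord_recl unlift_none /=; under eq_bigr do rewrite liftK /=.
by rewrite -h addrC subrK.
Qed.

(** The theorem of Weyl, by Fourier-Motzkin elimination: the coefficient t of
    one generator can be chosen iff each lower bound that the inequalities
    impose on t is below each upper bound. *)
Lemma pos_polyhedral N (x : 'I_N -> 'rV[R]_d) :
  exists us : seq 'rV[R]_d, forall v, pos x v <-> forall u, u \in us -> dot u v <= 0.
Proof.
elim: N x => [|N ih] x.
  exists ([seq delta_mx 0 i | i <- enum 'I_d] ++ [seq - delta_mx 0 i | i <- enum 'I_d]) => v.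
  have dotdelta i : dot (delta_mx 0 i) v = v 0 i.
    by rewrite /dot -rowE !mxE.
  split=> [[l _ ->] u _|h]; first by rewrite big_ord0 dot0r.
  exists (fun=> 0) => //; rewrite big_ord0; apply/rowP => i; rewrite mxE.
  apply/eqP; rewrite eq_le; apply/andP; split.
    by rewrite -dotdelta h// mem_cat map_f// mem_enum.
  rewrite -oppr_le0 -dotdelta -dotNl h// mem_cat; apply/orP; right.
  by apply/mapP; exists i; rewrite // mem_enum.
have [us hus] := ih (x \o lift ord0); pose a u := dot u (x ord0).
exists ([seq u <- us | a u <= 0] ++
  [seq a u *: w - a w *: u | u <- [seq u <- us | 0 < a u], w <- [seq w <- us | a w < 0]]) => v.
have dot_sub t u : dot u (v - t *: x ord0) = dot u v - t * a u.
  by rewrite dotDr -scaleNr dotZr mulNr.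
split=> [/pos_recl[t t0 /hus h] z|h].
  rewrite mem_cat => /orP[|/allpairsP[[u w] /=]].
    rewrite mem_filter => /andP[au /h]; rewrite dot_sub; nra.
  rewrite !mem_filter => -[/andP[au /h hu] /andP[aw /h hw] ->].
  rewrite dotBl !dotZl; rewrite !dot_sub in hu hw; nra.
apply/pos_recl.
have [t [t0 tE tmax]] := max_spec [seq dot u v / a u | u <- us & 0 < a u].
exists t => //; apply/hus => u uus; rewrite dot_sub.
have [au|au|au] := ltrgt0P (a u).
- have /tmax : dot u v / a u \in [seq dot u v / a u | u <- us & 0 < a u].
    by apply/mapP; exists u; rewrite // mem_filter au.
  by rewrite ler_pdivrMr// subr_le0.
- case: tE => [->|/mapP[w]].
    by rewrite mul0r subr0; apply: h; rewrite mem_cat mem_filter (ltW au) uus.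
  rewrite mem_filter => /andP[aw wus] ->.
  have : dot (a w *: u - a u *: w) v <= 0.
    apply: h; rewrite mem_cat; apply/orP; right; apply/allpairsP.
    by exists (w, u); rewrite /= !mem_filter aw au.
  rewrite dotBl !dotZl => hwu; rewrite -(pmulr_rle0 _ aw) mulrBr.
  rewrite (_ : a w * (_ * a u) = a u * dot w v)//.
  by field; rewrite gt_eqF.
- by rewrite au mulr0 subr0; apply: h; rewrite mem_cat mem_filter au lexx uus.
Qed.

Lemma pos_gen N (x : 'I_N -> 'rV[R]_d) i : pos x (x i).
Proof.
exists (fun j => (j == i)%:R) => [j|]; first by case: (_ == _).
rewrite (bigD1 i)//= eqxx scale1r big1 ?addr0// => j /negPf->.
by rewrite scale0r.
Qed.

Lemma dot_pos_le0 N (x : 'I_N -> 'rV[R]_d) v w :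
  (forall i, dot (x i) v <= 0) -> pos x w -> dot w v <= 0.
Proof.
move=> xv [l l0 ->]; rewrite dot_suml; apply: sumr_le0 => i _.
by rewrite dotZl mulr_ge0_le0.
Qed.

(** The lemma of Farkas for the whole space. *)
Lemma pos_properP N (x : 'I_N -> 'rV[R]_d) :
  pos x <> setT <-> exists2 v, v != 0 & forall i, dot (x i) v <= 0.
Proof.
split=> [pT|[v v0 xv] pT]; last first.
  have /(dot_pos_le0 xv) : pos x v by rewrite pT.
  by rewrite leNgt dot_self_gt0.
have [us hus] := pos_polyhedral x; apply: contrapT => nov; apply: pT.
apply/seteqP; split=> // w _; apply/hus => u uus.
have [->|u0] := eqVneq u 0; first by rewrite dot0l.
case: nov; exists u => // i; rewrite dotC.
by have /hus := pos_gen x i; exact.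
Qed.

End Weyl.

(** * Faces of a positive hull in general position *)

Section Faces.
Variables (R : realType) (d N : nat) (x : 'I_N -> 'rV[R]_d).
Implicit Types (J A : {set 'I_N}) (u v w : 'rV[R]_d).

Definition subpos J : set 'rV[R]_d :=
  [set v | exists2 l : 'I_N -> R, (forall i, 0 <= l i) & v = \sum_(i in J) l i *: x i].

Lemma subpos_gen J i : i \in J -> subpos J (x i).
Proof.
move=> iJ; exists (fun j => (j == i)%:R) => [j|]; first by case: (_ == _).
rewrite (bigD1 i)//= eqxx scale1r big1 ?addr0// => j /andP[_ /negPf->].
by rewrite scale0r.
Qed.

Lemma pos_perp v : (forall i, dot (x i) v <= 0) ->
  pos x `&` perp v = subpos [set i | dot (x i) v == 0].
Proof.
move=> xv; apply/seteqP; split=> w.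
  move=> [[l l0 wE] wv]; exists l => //; rewrite wE [RHS]big_mkcond /=.
  apply: eq_bigr => i _; rewrite inE; case: ifPn => // xiv.
  suff -> : l i = 0 by rewrite scale0r.
  have : \sum_j l j * - dot (x j) v = 0.
    move: wv; rewrite /perp /= dotC wE dot_suml => wv.
    under eq_bigr do rewrite mulrN -dotZl.
    by rewrite sumrN wv oppr0.
  move/eqP; rewrite psumr_eq0 => [/allP/(_ i (mem_index_enum i))|j _].
    by rewrite mulf_eq0 oppr_eq0 (negPf xiv) orbF => /eqP.
  by rewrite mulr_ge0// oppr_ge0.
move=> [l l0 wE]; split.
  exists (fun i => if dot (x i) v == 0 then l i else 0) => [i|].
    by case: ifP.
  rewrite wE big_mkcond; apply: eq_bigr => i _; rewrite inE.
  by case: ifP => // _; rewrite scale0r.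
rewrite /perp /= dotC wE dot_suml big1// => i; rewrite inE dotZl => /eqP->.
by rewrite mulr0.
Qed.

Lemma face_perp F : is_face (pos x) F ->
  exists2 v, forall i, dot (x i) v <= 0 & F = pos x `&` perp v.
Proof.
move=> [m [u [I [_ CE ->]]]]; exists (\sum_(i in I) u i).
  move=> i; have : halfspaces u finset.set0 (x i) by rewrite -CE; exact: pos_gen.
  move=> h; rewrite dotC dot_suml sumr_le0// => j _.
  by have := h j; rewrite inE.
rewrite CE; apply/seteqP; split=> w h.
  split; first by move=> i; have := h i; rewrite inE; case: ifP => // _ ->.
  by rewrite /perp /= dot_suml big1// => i iI; have := h i; rewrite iI.
move: h => [h]; rewrite /perp /= dot_suml => s0 i.
have hi := h i; rewrite inE in hi; case: ifP => // iI.
have : \sum_(i in I) - dot (u i) w = 0 by rewrite sumrN s0 oppr0.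
move/eqP; rewrite psumr_eq0 => [/allP/(_ i (mem_index_enum i))|j _].
  by rewrite iI oppr_eq0 => /eqP.
by rewrite oppr_ge0; have := h j; rewrite inE.
Qed.

Lemma perp_face v : v != 0 -> (forall i, dot (x i) v <= 0) ->
  is_face (pos x) (pos x `&` perp v).
Proof.
move=> v0 xv; have [us hus] := pos_polyhedral x.
(* The supporting half-space of v is put in front of those that define the cone. *)
pose ws := v :: [seq u <- us | u != 0].
have wsP i : (i < size ws)%N -> ws`_i != 0.
  move=> iw; have : ws`_i \in ws by rewrite mem_nth.
  by rewrite in_cons => /predU1P[->//|]; rewrite mem_filter => /andP[].
have hws w : pos x w <-> forall i : 'I_(size ws), dot ws`_i w <= 0.
  split=> [pw i|h].
    have : ws`_i \in ws by rewrite mem_nth.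
    rewrite in_cons => /predU1P[->|].
      by rewrite dotC; exact: dot_pos_le0 pw.
    by rewrite mem_filter => /andP[_]; exact: (proj1 (hus w)).
  apply/hus => u uus; have [->|u0] := eqVneq u 0; first by rewrite dot0l.
  have uws : u \in ws by rewrite in_cons mem_filter u0 uus orbT.
  have iw : (index u ws < size ws)%N by rewrite index_mem.
  by have := h (Ordinal iw); rewrite /= nth_index.
exists (size ws), (fun i => ws`_i), [set ord0]%SET; split=> [i||].
- exact: wsP.
- apply/seteqP; split=> w; first by move=> /hws h i; rewrite inE.
  by move=> h; apply/hws => i; have := h i; rewrite inE.
apply/seteqP; split=> w.
  move=> [/hws h wv] i; rewrite inE; case: eqP => [->|_]; last exact: h.
  exact: wv.
move=> h; split; last by have := h ord0; rewrite inE eqxx.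
by apply/hws => i; have := h i; rewrite inE; case: ifP => // _ ->.
Qed.

Lemma has_dim_subpos J k :
  has_dim (subpos J) k <-> \dim <<[seq x i | i in J]>>%VS = k.
Proof.
have sub (W : {vspace 'rV[R]_d}) : subpos J `<=` [set` W] <-> (<<[seq x i | i in J]>> <= W)%VS.
  split=> [h|/span_subvP h v [l _ ->]].
    by apply/span_subvP => _ /mapP[i + ->]; rewrite mem_enum => /subpos_gen/h.
  rewrite /= rpred_sum// => i iJ; rewrite rpredZ//.
  by apply: h; apply: map_f; rewrite mem_enum.
split=> [[V VP <-]|<-]; last by exists <<[seq x i | i in J]>>%VS.
suff -> : V = <<[seq x i | i in J]>>%VS by [].
apply/eqP; rewrite eqEsubv; apply/andP; split.
  by apply/(VP _)/sub.
by apply/sub/(VP _).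
Qed.

Hypotheses (dN : (d <= N)%N) (indep : any_lin_indep x).

(** Linear independence is given for families indexed by 'I_d; a smaller set of
    indices is extended by any others, of which there are enough as d <= N. *)
Lemma cover_inj A : (#|A| <= d)%N ->
  exists2 f : 'I_d -> 'I_N, injective f & forall i, i \in A -> exists k, f k = i.
Proof.
move=> Ad; pose s := enum A ++ enum (~: A).
have sz : size s = N.
  by rewrite size_cat -!cardE cardsC card_ord.
have us : uniq s.
  rewrite cat_uniq !enum_uniq andbT /=; apply/hasPn => i.
  by rewrite !mem_enum inE.
have [t tE] : exists t : N.-tuple 'I_N, val t = s by exists (Tuple (introT eqP sz)).
exists (fun k => tnth t (widen_ord dN k)) => [k l|i iA].
  have /tuple_uniqP ut : uniq t by rewrite tE.
  by move=> /ut/(congr1 val) /= kl; exact: val_inj.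
have is_ : (index i s < d)%N.
  rewrite /s index_cat mem_enum iA; apply: leq_trans Ad.
  by rewrite cardE index_mem mem_enum.
exists (Ordinal is_); rewrite (tnth_nth i) /= tE nth_index//.
by rewrite mem_cat mem_enum iA.
Qed.

(** Together with others, the forms of index in A make up an invertible matrix. *)
Lemma solve A (c : 'I_N -> R) : (#|A| <= d)%N ->
  exists u, forall i, i \in A -> dot (x i) u = c i.
Proof.
move=> /cover_inj[f f_inj fA]; pose M := \matrix_j x (f j).
have uM : M \in unitmx by rewrite -row_free_unit; exact: indep.
exists (invmx M *m \col_j c (f j))^T => i /fA[k <-].
rewrite /dot trmxK -(rowK (fun j => x (f j)) k) -/M -row_mul mulmxA mulmxV//.
by rewrite mul1mx !mxE.
Qed.

Lemma dot_eq0 A v : (d <= #|A|)%N -> (forall i, i \in A -> dot (x i) v = 0) -> v = 0.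
Proof.
move=> dA vA; pose f (k : 'I_d) : 'I_N := enum_val (widen_ord dA k).
have f_inj : injective f.
  by move=> k l /enum_val_inj/(congr1 val) /= kl; exact: val_inj.
have uM : \matrix_j x (f j) \in unitmx by rewrite -row_free_unit; exact: indep.
apply: trmx_inj; rewrite trmx0 -(mulKmx uM v^T) (_ : _ *m v^T = 0) ?mulmx0//.
apply/colP => k; rewrite [RHS]mxE -(vA (f k) (enum_valP _)) /dot.
by rewrite -(rowK (fun j => x (f j)) k) -row_mul [RHS]mxE.
Qed.

Lemma generic_indep : generic d setT x.
Proof.
split=> J cJ; last by move=> v _ /(dot_eq0 cJ)-> j; rewrite dot0r.
move=> j jJ; have [|u hu] := @solve (j |: J) (fun i => (i == j)%:R).
  by rewrite cardsU1 jJ.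
exists u; split=> // [i iJ|]; rewrite hu ?in_setU1 ?eqxx ?oner_neq0 ?iJ ?orbT//.
by case: eqP => // ij; rewrite -ij iJ in jJ.
Qed.

Lemma cell_neq0 J v : (#|J| < N)%N -> cell setT x J v -> v != 0.
Proof.
move=> JN [_ h]; apply: contraTneq JN => v0; rewrite -leqNgt.
rewrite -[leqLHS]card_ord subset_leq_card//; apply/fintype.subsetP => i _.
by have := h i; rewrite v0 dot0r ltxx; case: (i \in J).
Qed.

(** The inequalities off J become strict by moving v, scaled up, in a direction
    in which the forms off J that vanish at v decrease. *)
Lemma cell_perturb J v : (#|J| < d)%N -> v != 0 ->
  (forall i, dot (x i) v <= 0) -> (forall i, i \in J -> dot (x i) v = 0) ->
  cell setT x J !=set0.
Proof.
move=> Jd v0 xv vJ; pose Z : {set 'I_N} := [set i | dot (x i) v == 0]%SET.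
have Zd : (#|Z| <= d)%N.
  rewrite leqNgt; apply/negP => /ltnW dZ; move/eqP: v0; apply.
  by apply: (dot_eq0 dZ) => i; rewrite inE => /eqP.
have [u hu] := solve (fun i => - (i \notin J)%:R) Zd.
(* The summands with dot (x i) v = 0 are 0, since the inverse of 0 is 0. *)
pose t := \sum_i (`|dot (x i) u| / `|dot (x i) v|) + 1.
exists (t *: v + u); split=> // i; rewrite dotDr dotZr.
have [/eqP zi|zi] := boolP (dot (x i) v == 0).
  rewrite zi mulr0 add0r hu ?inE ?zi//.
  by case: (i \in J); rewrite ?oppr0// oppr_lt0.
rewrite ifN; last by apply: contra zi => /vJ->.
have xiv : dot (x i) v < 0 by rewrite lt_neqAle zi xv.
have nv : `|dot (x i) v| = - dot (x i) v by rewrite ltr0_norm.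
have : `|dot (x i) u| / `|dot (x i) v| + 1 <= t.
  by rewrite lerD2r (bigD1 i)//= lerDl sumr_ge0.
rewrite nv -lerBrDr ler_pdivrMr ?oppr_gt0//.
have := ler_norm (dot (x i) u); nra.
Qed.

Lemma free_gens m (f : 'I_m -> 'I_N) : injective f -> (m <= d)%N ->
  free [tuple x (f i) | i < m].
Proof.
move=> f_inj md; apply/freeP => k; under eq_bigr do rewrite -tnth_nth tnth_mktuple.
move=> k0 i0; pose A : {set 'I_N} := [set f i | i : 'I_m]%SET.
have Ad : (#|A| <= d)%N by rewrite card_imset// card_ord.
have [u hu] := solve (fun i => (i == f i0)%:R) Ad.
have := dot0l u; rewrite -k0 dot_suml (bigD1 i0)//= big1 => [|i ii0].
  by rewrite addr0 dotZl hu ?imset_f// eqxx mulr1.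
by rewrite dotZl hu ?imset_f// (inj_eq f_inj) (negPf ii0) mulr0.
Qed.

Lemma dim_inj_le J m (f : 'I_m -> 'I_N) : injective f -> (m <= d)%N ->
  (forall i, f i \in J) -> (m <= \dim <<[seq x i | i in J]>>)%N.
Proof.
move=> f_inj md fJ; have := free_gens f_inj md; rewrite /free size_tuple => /eqP mE.
rewrite -{1}mE; apply/dimvS/sub_span => _ /mapP[i _ ->].
by apply: map_f; rewrite mem_enum.
Qed.

Lemma dim_subpos J : (#|J| <= d)%N -> \dim <<[seq x i | i in J]>>%VS = #|J|.
Proof.
move=> Jd; apply/eqP; rewrite eqn_leq; apply/andP; split.
  by apply: leq_trans (dim_span _) _; rewrite size_map -cardE.
by apply: (dim_inj_le (@enum_val_inj _ (mem J))) => // i; exact: enum_valP.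
Qed.

Lemma cell_le0 J v i : cell setT x J v -> dot (x i) v <= 0.
Proof. by move=> [_ /(_ i)]; case: ifP => // _ => [->|/ltW]. Qed.

Lemma cell_zeros J v : cell setT x J v -> [set i | dot (x i) v == 0]%SET = J.
Proof.
move=> [_ h]; apply/setP => i; have := h i; rewrite inE.
by case: ifP => _ => [->|/lt_eqF]; rewrite ?eqxx.
Qed.

Lemma cell_face J v : (#|J| < N)%N -> cell setT x J v -> is_face (pos x) (subpos J).
Proof.
move=> JN vJ; rewrite -(cell_zeros vJ) -pos_perp; last by move=> i; exact: cell_le0 vJ.
apply: perp_face; first exact: cell_neq0 vJ.
by move=> i; exact: cell_le0 vJ.
Qed.

Lemma subpos_sub J J' v : cell setT x J v -> subpos J' `<=` subpos J -> J' \subset J.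
Proof.
move=> vJ sub; apply/fintype.subsetP => i /subpos_gen/sub[l _ xi].
rewrite -(cell_zeros vJ) inE xi dot_suml big1// => j jJ.
by have [_ /(_ j)] := vJ; rewrite jJ dotZl => ->; rewrite mulr0.
Qed.

Lemma face_subpos F k : (k < d)%N -> is_face (pos x) F -> has_dim F k ->
  exists J, [/\ #|J| = k, cell setT x J !=set0 & F = subpos J].
Proof.
move=> kd /face_perp[v xv ->]; rewrite (pos_perp xv).
set J := [set i | _]%SET => /has_dim_subpos dk.
have Jd : (#|J| < d)%N.
  rewrite ltnNge; apply/negP => dJ.
  have finj : injective (fun i : 'I_d => enum_val (widen_ord dJ i)).
    by move=> i j /enum_val_inj/(congr1 val) /= ij; exact: val_inj.
  have := dim_inj_le finj (leqnn d) (fun i => enum_valP (widen_ord dJ i)).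
  by rewrite dk leqNgt kd.
exists J; split=> //; first by rewrite -dk dim_subpos// ltnW.
exists v; split=> // i; rewrite inE; case: eqP => // /eqP n0.
by rewrite lt_neqAle n0 xv.
Qed.

(** A face is cut out by a supporting hyperplane, and is the hull of the generators
    on it. For dimensions below d these are linearly independent, so that there
    are k of them, and the face determines them. *)
Lemma nfaces_fcount k : (k < d)%N -> nfaces k (pos x) = fcount k setT x.
Proof.
move=> kd; pose B : {set {set 'I_N}} :=
  [set J : {set 'I_N} | (#|J| == k) && `[< cell setT x J !=set0 >]]%SET.
have -> : fcount k setT x = #|B|.
  rewrite /fcount -sum1_card big_mkcond [RHS]big_mkcond; apply: eq_bigr => J _.
  by rewrite /B inE /nonempty; case: ifP => // _; case: asboolP.
pose s := [seq subpos J | J <- enum B].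
have -> : nfaces k (pos x) = size (undup s).
  rewrite -card_fseq /nfaces; congr (#|` _|).
  rewrite -[RHS]set_fsetK; congr fset_set.
  apply/seteqP; split=> F /=; rewrite in_fset /s /=.
    case=> face dimF; have [J [Jk cJ ->]] := face_subpos kd face dimF.
    by apply: map_f; rewrite mem_enum inE Jk eqxx/=; exact/asboolP.
  case/mapP => J; rewrite mem_enum inE => /andP[/eqP Jk /asboolP[v vJ]] ->; split.
    by apply: cell_face vJ; rewrite Jk; exact: leq_trans dN.
  by apply/has_dim_subpos; rewrite dim_subpos ?Jk// ltnW.
rewrite undup_id /s ?size_map -?cardE//.
rewrite map_inj_in_uniq ?enum_uniq// => J J'.
rewrite !mem_enum !inE => /andP[_ /asboolP[v vJ]] /andP[_ /asboolP[v' vJ']] e.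
apply/eqP; rewrite finset.eqEsubset; apply/andP; split.
  by apply: subpos_sub vJ' _; rewrite e.
by apply: subpos_sub vJ _; rewrite e.
Qed.

End Faces.

(** * Non-emptiness of cells as properness of positive hulls *)

Section Doubling.
Variables (R : realType) (d N : nat).
Implicit Types (x : 'I_N -> 'rV[R]_d) (J : {set 'I_N}).

(** The cell of J is non-empty iff the positive hull of this family is proper,
    which expresses the non-emptiness of cells by measurable events. The
    generators off J are repeated so that the index type does not depend on J. *)
Definition doubled J x (i : 'I_(N + N)) : 'rV[R]_d :=
  match fintype.split i with
  | inl j => x j
  | inr j => if j \in J then - x j else x j
  end.

Lemma doubled_le0 J x v : (forall i, dot (doubled J x i) v <= 0) <->
  (forall i, dot (x i) v <= 0) /\ (forall i, i \in J -> dot (x i) v = 0).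
Proof.
split=> [h|[h1 h2] i]; last first.
  rewrite /doubled; case: fintype.split => j //.
  by case: ifP => // jJ; rewrite dotNl h2 ?oppr0.
have h1 i : dot (x i) v <= 0.
  have := h (lshift N i); rewrite /doubled.
  by case: split_ordP => j /eqP; rewrite ?eq_lshift ?eq_lrshift// => /eqP->.
split=> // i iJ; apply/eqP; rewrite eq_le h1 /=.
have := h (rshift N i); rewrite /doubled.
case: split_ordP => j /eqP; rewrite ?eq_rshift ?eq_rlshift// => /eqP<-.
by rewrite iJ dotNl oppr_le0.
Qed.

Lemma doubled_proper J x : pos (doubled J x) <> setT -> pos x <> setT.
Proof.
by move=> /pos_properP[v v0 /doubled_le0[xv _]]; apply/pos_properP; exists v.
Qed.

Lemma doubled_cell J x : (d <= N)%N -> any_lin_indep x -> (#|J| < d)%N ->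
  pos (doubled J x) <> setT <-> cell setT x J !=set0.
Proof.
move=> dN indep Jd; split=> [/pos_properP[v v0 /doubled_le0[xv vJ]]|[v vJ]].
  exact: cell_perturb vJ.
apply/pos_properP; exists v; first by apply: cell_neq0 vJ; exact: leq_trans dN.
apply/doubled_le0; split=> i; first exact: cell_le0 vJ.
by have [_ /(_ i)] := vJ; case: ifP.
Qed.

End Doubling.

(** * Expected numbers of events *)

Section Events.
Local Open Scope ereal_scope.
Context (disp : measure_display) (T : measurableType disp) (R : realType).
Implicit Types mu : {measure set T -> \bar R}.

Lemma ge0_le_integral_nomeas mu (f g : T -> \bar R) :
  (forall w, 0 <= f w) -> (forall w, f w <= g w) ->
  \int[mu]_w f w <= \int[mu]_w g w.
Proof.
move=> f0 fg; have g0 w : 0 <= g w by exact: le_trans (fg w).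
rewrite !ge0_integralTE//; apply: ereal_sup_le => _ [h /= hf <-].
by exists h => // w; exact: le_trans (fg w).
Qed.

(** The values of f on a null set do not matter even if f is not measurable:
    the integral of f lies between those of two measurable functions. *)
Lemma ge0_integral_null mu (N : set T) (f g : T -> \bar R) :
  measurable N -> mu N = 0 -> measurable_fun setT g ->
  (forall w, 0 <= f w) -> (forall w, 0 <= g w) ->
  (forall w, ~ N w -> f w = g w) -> \int[mu]_w f w = \int[mu]_w g w.
Proof.
move=> mN N0 mg f0 g0 fg.
pose lo := g \_ (~` N); pose up := lo \+ (cst +oo \_ N).
have mlo : measurable_fun setT lo.
  by apply/(measurable_restrictT _ (measurableC mN)); exact: measurable_funS mg.
have mup : measurable_fun setT up.
  by apply: emeasurable_funD => //; apply/(measurable_restrictT _ mN).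
have loE w : ~ N w -> lo w = g w by move=> Nw; rewrite /lo patchE mem_set.
have loN w : N w -> lo w = 0.
  by move=> Nw; rewrite /lo patchE memNset// => h; exact: h.
have upE w : ~ N w -> up w = g w.
  by move=> Nw; rewrite /up /= loE// patchE memNset// adde0.
have upN w : N w -> up w = +oo.
  by move=> Nw; rewrite /up /= loN// patchE mem_set.
have lo0 w : 0 <= lo w by have [/loN->|/loE->] := pselect (N w).
have up0 w : 0 <= up w by have [/upN->|/upE->] := pselect (N w).
have lof w : lo w <= f w.
  by have [Nw|Nw] := pselect (N w); [rewrite loN | rewrite loE// fg].
have fup w : f w <= up w.
  by have [Nw|Nw] := pselect (N w); [rewrite upN// leey | rewrite upE// fg].
have ae h : (forall w, ~ N w -> h w = g w) -> ae_eq mu setT h g.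
  by move=> hg; exists N; split=> // w /= hw; apply: contrapT => /hg e; exact: hw.
have intup : \int[mu]_w up w = \int[mu]_w g w.
  by apply: ge0_ae_eq_integral => //; exact: ae.
have intlo : \int[mu]_w lo w = \int[mu]_w g w.
  by apply: ge0_ae_eq_integral => //; exact: ae.
apply/eqP; rewrite eq_le -{1}intup -intlo.
by apply/andP; split; exact: ge0_le_integral_nomeas.
Qed.

Lemma integral_count mu (I : Type) (s : seq I) (E : I -> set T) (N : set T) (f : T -> nat) :
  (forall i, measurable (E i)) -> measurable N -> mu N = 0 ->
  (forall w, ~ N w -> f w = \sum_(i <- s) `[< E i w >])%N ->
  \int[mu]_w (f w)%:R%:E = \sum_(i <- s) mu (E i).
Proof.
move=> mE mN N0 fE.
have mi i : measurable_fun setT (fun w => (\1_(E i) w)%:E : \bar R).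
  by apply/measurable_EFinP; exact: measurable_indic.
rewrite (@ge0_integral_null _ N _ (fun w => \sum_(i <- s) (\1_(E i) w)%:E))//; last 3 first.
- exact: emeasurable_sum.
- by move=> w; rewrite sume_ge0// => i _; rewrite lee_fin.
- move=> w /fE->; rewrite sumEFin natr_sum; congr (_%:E); exact: eq_bigr.
rewrite ge0_integral_sum//.
by apply: eq_bigr => i _; rewrite integral_indic// setIT.
Qed.

End Events.

(** * The expected number of faces as a ratio of totals *)

Section ExpectedFaces.
Context (disp : measure_display) (T : measurableType disp) (R : realType).
Variables (P : probability T R) (d : nat).

Lemma random_vectors_doubled N (X : T -> 'I_N -> 'rV[R]_d) J :
  random_vectors X -> random_vectors (fun w => doubled J (X w)).
Proof.
move=> mX i j; rewrite /doubled; case: fintype.split => l; first exact: mX.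
case: (l \in J); last exact: mX.
under eq_fun do rewrite mxE; exact: measurableT_comp (mX l j).
Qed.

Lemma measurable_doubled N (X : T -> 'I_N -> 'rV[R]_d) J :
  random_vectors X -> measurable (proper_pos (fun w => doubled J (X w))).
Proof. by move=> mX; apply/measurable_proper_pos/random_vectors_doubled. Qed.

Lemma proper_pos_doubled0 N (X : T -> 'I_N -> 'rV[R]_d) :
  proper_pos (fun w => doubled finset.set0 (X w)) = proper_pos X.
Proof.
apply/seteqP; split=> w; first exact: doubled_proper.
move=> /pos_properP[v v0 xv]; apply/pos_properP; exists v => //.
by apply/doubled_le0; split=> // i; rewrite inE.
Qed.

Lemma mnormalizeE (mu : {measure set T -> \bar R}) p (B : set T) :
  mu setT = p%:E -> p != 0 -> mnormalize mu P B = (mu B * p^-1%:E)%E.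
Proof. by move=> muT p0; rewrite /mnormalize muT eqe (negPf p0). Qed.

Lemma cond_probE (A : set T) (mA : measurable A) p (B : set T) :
  P A = p%:E -> p != 0 -> cond_prob P mA B = (P (B `&` A) * p^-1%:E)%E.
Proof.
move=> PA; have PT : mrestr P mA setT = p%:E by rewrite /mrestr setTI.
exact: mnormalizeE.
Qed.

(** The events whose number is f_k have the same probability for all members of the
    family X. So Tk, the total of their indicators over the family, is the order
    of W times the expectation of f_k on the event of properness, and T0 is the
    order of W times the probability of this event. *)
Lemma expected_faces (W : finType) N k (Tk T0 : nat)
    (X : W -> T -> 'I_N -> 'rV[R]_d) (X0 : T -> 'I_N -> 'rV[R]_d)
    (mX0 : random_vectors X0) :
  (d <= N)%N -> (k < d)%N -> (0 < T0)%N ->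
  (forall g, random_vectors (X g)) ->
  (forall g J, P (proper_pos (fun w => doubled J (X g w))) =
               P (proper_pos (fun w => doubled J (X0 w)))) ->
  {ae P, forall w, [/\ any_lin_indep (X0 w), forall g, any_lin_indep (X g w),
    \sum_g fcount k setT (X g w) = Tk & \sum_g fcount 0 setT (X g w) = T0]%N} ->
  'E_(cond_prob P (measurable_proper_pos mX0))[(fun w => (nfaces k (pos (X0 w)))%:R)]%E =
  (Tk%:R / T0%:R)%:E.
Proof.
move=> dN kd T0_gt0 mX same [Z [mZ Z0 Zsub]].
have good w : ~ Z w -> [/\ any_lin_indep (X0 w), forall g, any_lin_indep (X g w),
    \sum_g fcount k setT (X g w) = Tk & \sum_g fcount 0 setT (X g w) = T0]%N.
  by move=> Zw; apply: contrapT => h; apply: Zw; exact: Zsub.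
pose E J := proper_pos (fun w => doubled J (X0 w)).
have mE J : measurable (E J) by exact: measurable_doubled.
have [q qE] : exists q : {set 'I_N} -> R, forall J, P (E J) = (q J)%:E.
  by exists (fun J => fine (P (E J))) => J; rewrite fineK// fin_num_measure.
pose Js (j : nat) := seq.filter (fun J : {set 'I_N} => #|J| == j) (index_enum _).
have fcountE (x : 'I_N -> 'rV[R]_d) j : any_lin_indep x -> (j < d)%N ->
    fcount j setT x = (\sum_(J <- Js j) `[< pos (doubled J x) <> setT >])%N.
  move=> indep jd; rewrite /fcount /Js big_filter; apply: eq_bigr => J /eqP Jj.
  rewrite /nonempty; congr nat_of_bool; apply/asboolP/asboolP => h.
    by apply/doubled_cell => //; rewrite Jj.
  by apply/(doubled_cell dN indep) => //; rewrite Jj.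
(* The constant total is integrated over the probability space. *)
have total j Tj : (j < d)%N -> (forall w, ~ Z w -> \sum_g fcount j setT (X g w) = Tj)%N ->
    #|W|%:R * \sum_(J <- Js j) q J = Tj%:R.
  move=> jd TjE.
  have := @integral_count _ _ _ P _ [seq (g, J) | g <- index_enum W, J <- Js j]
    (fun gJ => proper_pos (fun w => doubled gJ.2 (X gJ.1 w))) Z (fun=> Tj).
  rewrite integral_cst// => H; apply: EFin_inj.
  transitivity (Tj%:R%:E * P setT)%E; last by rewrite probability_setT mule1.
  apply: etrans (esym (H _ mZ Z0 _)); last 2 first.
  - by move=> gJ; exact: measurable_doubled.
  - move=> w Zw; rewrite -(TjE w Zw) big_allpairs; apply: eq_bigr => g _.
    by apply: fcountE => //; have [_ /(_ g)] := good w Zw.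
  rewrite big_allpairs /=; under [RHS]eq_bigr do under eq_bigr do rewrite same qE.
  under [RHS]eq_bigr do rewrite sumEFin.
  by rewrite sumEFin sumr_const mulr_natl.
have Pproper : P (proper_pos X0) = (q finset.set0)%:E.
  by rewrite -qE /E proper_pos_doubled0.
have T0E : #|W|%:R * q finset.set0 = T0%:R.
  rewrite -(total 0%N T0); [|exact: leq_ltn_trans kd|by move=> w /good[]].
  rewrite /Js big_filter (big_pred1 finset.set0)// => J; by rewrite cards_eq0.
have TkE : #|W|%:R * \sum_(J <- Js k) q J = Tk%:R.
  by apply: total => // w /good[].
have : #|W|%:R * q finset.set0 != 0 by rewrite T0E pnatr_eq0 -lt0n.
rewrite mulf_eq0 => /norP[W0 q0].
rewrite unlock.
rewrite (@integral_count _ _ _ _ _ (Js k) E Z)//; last 2 first.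
- apply: (etrans (cond_probE _ Z Pproper q0)); rewrite (_ : P _ = 0%E) ?mul0e//.
  apply: (subset_measure0 _ mZ _ Z0); last by move=> w [].
  by apply: measurableI => //; exact: measurable_proper_pos.
- by move=> w /good[indep _ _ _]; rewrite (nfaces_fcount dN indep kd) fcountE.
transitivity (\sum_(J <- Js k) (q J / q finset.set0)%:E)%E.
  apply: eq_bigr => J _; apply: (etrans (cond_probE _ (E J) Pproper q0)).
  rewrite setIidl ?qE//.
  by move=> w; exact: doubled_proper.
rewrite sumEFin -mulr_suml -T0E -TkE; congr EFin.
by field; rewrite W0 q0.
Qed.

(** The event is the preimage, under the joint value, of the event that F defines
    for the coordinate vectors on the space of tuples; the latter is measurable
    for the same reason as the former. *)
Lemma same_distribution_proper n N (Y Z : T -> 'I_n -> 'rV[R]_d)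
    (F : ('I_n -> 'rV[R]_d) -> 'I_N -> 'rV[R]_d) :
  (forall disp' (T' : measurableType disp') (Y' : T' -> 'I_n -> 'rV[R]_d),
     random_vectors Y' -> random_vectors (fun w => F (Y' w))) ->
  same_distribution P Y Z ->
  P (proper_pos (fun w => F (Y w))) = P (proper_pos (fun w => F (Z w))).
Proof.
move=> mF YZ.
pose coords (z : n.-tuple (d.-tuple (measurableTypeR R))) (i : 'I_n) : 'rV[R]_d :=
  \row_j tnth (tnth z i) j.
have coordsK (Y' : T -> 'I_n -> 'rV[R]_d) w : coords (joint Y' w) = Y' w.
  by apply/funext => i; apply/rowP => j; rewrite mxE !tnth_mktuple.
have mcoords : random_vectors coords.
  move=> i j; under eq_fun do rewrite mxE.
  exact: measurableT_comp (measurable_tnth j) (measurable_tnth i).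
have := YZ _ (measurable_proper_pos (mF _ _ _ mcoords)).
rewrite /pushforward /proper_pos /preimage /=.
by under eq_set do rewrite coordsK; under [in RHS]eq_set do rewrite coordsK.
Qed.

End ExpectedFaces.

(** * The two types of dual Weyl cones *)

(** Provides the inequalities between n and d, which are part of the definition of
    general position. *)
Lemma ae_witness (disp : measure_display) (T : measurableType disp) (R : realType)
    (P : probability T R) (Q : T -> Prop) : {ae P, forall w, Q w} -> exists w, Q w.
Proof.
move=> [Z [mZ Z0 QZ]]; apply: contrapT => noQ.
have ZT : Z = setT.
  by apply/seteqP; split=> // w _; apply: QZ => Qw; apply: noQ; exists w.
by move: Z0; rewrite ZT probability_setT => /eqP; rewrite onee_eq0.
Qed.

Section DualWeylExpectations.
Context (R : realType) (d : nat) (disp : measure_display) (T : measurableType disp)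
  (P : probability T R).

Lemma general_positionA_indep n (y : 'I_n.+1 -> 'rV[R]_d) : general_positionA y ->
  any_lin_indep (weylA y).
Proof.
move=> [_ /(_ 1%g)]; rewrite (_ : y \o (1%g : 'S_n.+1) = y)//.
by apply/funext => i; rewrite /= perm1.
Qed.

Lemma genericA_general_position n (y : 'I_n.+1 -> 'rV[R]_d) :
  general_positionA y -> genericA d setT y.
Proof.
by move=> [dn gy] s; rewrite -weylA_chain; apply: generic_indep.
Qed.

Lemma general_positionB_indep n (y : 'I_n -> 'rV[R]_d) : general_positionB y ->
  any_lin_indep (weylB y).
Proof.
move=> [_ /(_ (fun=> false) 1%g)]; rewrite (_ : signed_perm _ _ y = y)//.
by apply/funext => i; rewrite /signed_perm perm1 scale1r.
Qed.

Lemma genericB_general_position n (y : 'I_n -> 'rV[R]_d) :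
  general_positionB y -> genericB d setT y.
Proof.
by move=> [dn gy] t s; rewrite -weylB_chain; apply: generic_indep.
Qed.

Lemma random_vectors_perm n (Y : T -> 'I_n -> 'rV[R]_d) (s : 'S_n) :
  random_vectors Y -> random_vectors (fun w => Y w \o s).
Proof. by move=> mY i j; exact: mY. Qed.

Lemma random_vectors_signed_perm n (Y : T -> 'I_n -> 'rV[R]_d) e (s : 'S_n) :
  random_vectors Y -> random_vectors (fun w => signed_perm e s (Y w)).
Proof.
move=> mY i j; rewrite /signed_perm; under eq_fun do rewrite mxE.
by apply: measurable_funM; [exact: measurable_cst | exact: mY].
Qed.

Lemma expected_facesA n k (Y : T -> 'I_n -> 'rV[R]_d) (mY : random_vectors Y) :
  (k < d)%N -> exchangeable P Y -> {ae P, forall w, general_positionA (Y w)} ->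
  ('E_(dual_weyl_probA P mY)[(fun w => (nfaces k (dual_weyl_coneA Y w))%:R)])%E =
    ('C(n.-1, k)%:R * (DA (n - k) (d - k))%:R / (DA n d)%:R
      * (n`!%:R / (n - k)`!%:R))%:E.
Proof.
move=> kd exch ae; have [w0 gw0] := ae_witness ae.
have [dn _] := gw0; case: n Y mY exch ae gw0 dn => // n Y mY exch ae gw0 dn.
have sT := @subspaceT R d; have g0 := genericA_general_position gw0.
have kn : (k <= n)%N by apply: leq_trans (ltnW kd) _.
have val0 w : general_positionA (Y w) -> totalA 0 setT (Y w) = chambers succn n d.
  by move=> /genericA_general_position/totalA0E; exact.
have valk w : general_positionA (Y w) -> totalA k setT (Y w) = totalA k setT (Y w0).
  move=> /genericA_general_position gw; apply/eqP.
  rewrite -(eqn_pmul2r (fact_gt0 (n.+1 - k))).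
  by rewrite (totalAE (ltnW kd) kn sT gw) (totalAE (ltnW kd) kn sT g0).
have pos_ch m : (0 < chambers succn m d)%N by rewrite -(ltn_predK kd) chambers_gt0.
rewrite /dual_weyl_probA /dual_weyl_coneA.
rewrite (@expected_faces _ _ _ P d 'S_n.+1 n k (totalA k setT (Y w0))
  (chambers succn n d) (fun s w => weylA (Y w \o s)))//; last first.
- apply: filterS ae => w gw; split.
  + exact: general_positionA_indep.
  + by case: gw.
  + by rewrite -(valk w gw); apply: eq_bigr => s _; rewrite weylA_chain.
  + by rewrite -(val0 w gw); apply: eq_bigr => s _; rewrite weylA_chain.
- move=> s J; symmetry.
  apply: (@same_distribution_proper _ _ _ P d n.+1 _ Y (fun w => Y w \o s)
    (fun y => doubled J (weylA y))) (exch s).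
  by move=> disp' T' Y' mY'; apply: random_vectors_doubled; exact: random_vectors_weylA mY'.
- by move=> s; exact: random_vectors_weylA (random_vectors_perm s mY).
have totalE : (totalA k setT (Y w0))%:R * (n.+1 - k)`!%:R =
    'C(n, k)%:R * n.+1`!%:R * (chambers succn (n - k) (d - k))%:R :> R.
  by rewrite -!natrM (totalAE (ltnW kd) kn sT g0).
have -> : DA n.+1 d = chambers succn n d.
  by case: n {Y mY exch ae gw0 g0 kn val0 valk totalE} dn => [|n _]; [lia | exact: DA_chambers].
have -> : DA (n.+1 - k) (d - k) = chambers succn (n - k) (d - k).
  rewrite subSn//; have : (0 < n - k)%N by lia.
  by case: (n - k)%N => // m _; exact: DA_chambers.
congr EFin; have f0 : (n.+1 - k)`!%:R != 0 :> R by rewrite pnatr_eq0 -lt0n fact_gt0.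
have c0 : (chambers succn n d)%:R != 0 :> R by rewrite pnatr_eq0 -lt0n.
rewrite -[X in X / _](mulfK f0) totalE /=.
by field; rewrite c0 f0.
Qed.

Lemma expected_facesB n k (Y : T -> 'I_n -> 'rV[R]_d) (mY : random_vectors Y) :
  (k < d)%N -> sym_exchangeable P Y -> {ae P, forall w, general_positionB (Y w)} ->
  ('E_(dual_weyl_probB P mY)[(fun w => (nfaces k (dual_weyl_coneB Y w))%:R)])%E =
    (2 ^+ k * 'C(n, k)%:R * (DB (n - k) (d - k))%:R / (DB n d)%:R
      * (n`!%:R / (n - k)`!%:R))%:E.
Proof.
move=> kd exch ae; have [w0 gw0] := ae_witness ae.
have [dn _] := gw0; pose b m := m.*2.+1.
have sT := @subspaceT R d; have g0 := genericB_general_position gw0.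
have kn : (k <= n)%N by apply: leq_trans (ltnW kd) _.
have val0 w : general_positionB (Y w) -> totalB 0 setT (Y w) = chambers b n d.
  by move=> /genericB_general_position/totalB0E; exact.
have valk w : general_positionB (Y w) -> totalB k setT (Y w) = totalB k setT (Y w0).
  move=> /genericB_general_position gw; apply/eqP.
  rewrite -(eqn_pmul2r (fact_gt0 (n - k))).
  by rewrite (totalBE (ltnW kd) kn sT gw) (totalBE (ltnW kd) kn sT g0).
have pos_ch m : (0 < chambers b m d)%N by rewrite -(ltn_predK kd) chambers_gt0.
rewrite /dual_weyl_probB /dual_weyl_coneB.
rewrite (@expected_faces _ _ _ P d ({ffun 'I_n -> bool} * 'S_n)%type n k
  (totalB k setT (Y w0)) (chambers b n d)
  (fun es w => weylB (signed_perm es.1 es.2 (Y w))))//; last first.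
- apply: filterS ae => w gw; split.
  + exact: general_positionB_indep.
  + by case: gw.
  + rewrite -(valk w gw) /totalB [RHS]pair_big /=.
    by apply: eq_bigr => es _; rewrite weylB_chain.
  + rewrite -(val0 w gw) /totalB [RHS]pair_big /=.
    by apply: eq_bigr => es _; rewrite weylB_chain.
- move=> es J; symmetry.
  apply: (@same_distribution_proper _ _ _ P d n _ Y
    (fun w => signed_perm es.1 es.2 (Y w)) (fun y => doubled J (weylB y))) (exch es.1 es.2).
  by move=> disp' T' Y' mY'; apply/random_vectors_doubled/random_vectors_weylB.
- by move=> es; apply/random_vectors_weylB/random_vectors_signed_perm.
have totalE : (totalB k setT (Y w0))%:R * (n - k)`!%:R =
    2 ^+ k * 'C(n, k)%:R * n`!%:R * (chambers b (n - k) (d - k))%:R :> R.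
  by rewrite -natrX -!natrM (totalBE (ltnW kd) kn sT g0).
have -> : DB n d = chambers b n d.
  have : (0 < n)%N by lia.
  by case: (n) => // m _; exact: DB_chambers.
have -> : DB (n - k) (d - k) = chambers b (n - k) (d - k).
  have : (0 < n - k)%N by lia.
  by case: (n - k)%N => // m _; exact: DB_chambers.
congr EFin; have f0 : (n - k)`!%:R != 0 :> R by rewrite pnatr_eq0 -lt0n fact_gt0.
have c0 : (chambers b n d)%:R != 0 :> R by rewrite pnatr_eq0 -lt0n.
rewrite -[X in X / _](mulfK f0) totalE -/b.
by field; rewrite c0 f0.
Qed.

End DualWeylExpectations.

Theorem corollary1p15 (R : realType) (d : nat) (hd : (2 <= d)%N)
    (disp : measure_display) (T : measurableType disp) (P : probability T R)
    (n k : nat) (hk : (k < d)%N) (Y : T -> 'I_n -> 'rV[R]_d)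
    (mY : random_vectors Y) :
  (exchangeable P Y ->
   {ae P, forall w, general_positionA (Y w)} ->
   ('E_(dual_weyl_probA P mY)[(fun w => (nfaces k (dual_weyl_coneA Y w))%:R)])%E =
     ('C(n.-1, k)%:R * (DA (n - k) (d - k))%:R / (DA n d)%:R
      * (n`!%:R / (n - k)`!%:R))%:E) /\
  (sym_exchangeable P Y ->
   {ae P, forall w, general_positionB (Y w)} ->
   ('E_(dual_weyl_probB P mY)[(fun w => (nfaces k (dual_weyl_coneB Y w))%:R)])%E =
     (2 ^+ k * 'C(n, k)%:R * (DB (n - k) (d - k))%:R / (DB n d)%:R
      * (n`!%:R / (n - k)`!%:R))%:E).
Proof.
by split=> exch ae; [exact: expected_facesA | exact: expected_facesB].
Qed.
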